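(* Let $X$ be a full $d$-dimensional shift on a finite alphabet and $\phi:X\to \mathbb R$ be a continuous potential. If $\sum_{n\geq 1} n^{d-1}\mathrm{var}_n\phi<\infty$ then $\phi$ cannot have a freezing phase transition.
   Context: $X=\mathcal A^{\mathbb Z^d}$ with $\mathcal A$ finite and the shift action. $\mathrm{var}_n\phi=\sup\{|\phi(x)-\phi(y)|: x|_{[-n,n]^d\cap\mathbb Z^d}=y|_{[-n,n]^d\cap\mathbb Z^d}\}$. For $\beta\in\mathbb R$, $\mathrm{ES}(\beta\phi)$ is the set of shift-invariant probability measures $\mu$ maximizing $h(\mu)+\beta\int\phi\,d\mu$, where $h$ is measure-theoretic entropy. $\phi$ has a freezing phase transition at $\beta_c$ if $\mathrm{ES}(\beta\phi)=\mathrm{ES}(\beta'\phi)$ for all $\beta,\beta'>\beta_c$ while $\mathrm{ES}(\beta\phi)\ne\mathrm{ES}(\beta'\phi)$ for any $\beta<\beta_c<\beta'$. *)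

(* Defs.v *)
From HB Require Import structures.
From mathcomp Require Import all_boot all_order all_algebra.
From mathcomp Require Import all_classical all_reals all_analysis.
Set Implicit Arguments. Unset Strict Implicit. Unset Printing Implicit Defensive.
Import Order.TTheory GRing.Theory Num.Theory.
Import numFieldNormedType.Exports.
Local Open Scope classical_set_scope.
Local Open Scope ring_scope.

Definition site (d : nat) := 'I_d -> int.

Section FullShift.
Variables (d : nat) (A : finType) (a0 : A).

(* carrier of the full shift A^(Z^d); a0 only serves to make it a pointedType *)
#[non_forgetful_inheritance]
HB.instance Definition _ := isPointed.Build A a0.
Definition cfg : pointedType := site d -> A.

Definition in_box (n : nat) (v : site d) : Prop := forall i, `|v i| <= n%:Z.

Definition box_site (n : nat) (p : {ffun 'I_d -> 'I_(n.*2.+1)}) : site d :=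
  fun i => (p i)%:Z - n%:Z.

Definition pattern (n : nat) := {ffun {ffun 'I_d -> 'I_(n.*2.+1)} -> A}.
Definition cylinder (n : nat) (w : pattern n) : set cfg :=
  [set x | forall p, x (box_site p) = w p].

Definition cylinders : set (set cfg) :=
  [set C | exists n (w : pattern n), C = cylinder w].

(* X with the Borel (= product = cylinder-generated) sigma-algebra *)
Definition X : measurableType _ := g_sigma_algebraType cylinders.

Definition shift (u : site d) (x : X) : X := fun v => x (fun i => v i + u i).

Variable R : realType.

Definition shift_invariant (mu : probability X R) : Prop :=
  forall (u : site d) (B : set X), measurable B ->
    mu (shift u @^-1` B) = mu B.

(* measure-theoretic entropy of a shift-invariant measure on the full shift,
   computed with the (generating) time-zero partition:
   h(mu) = lim_n (2n+1)^{-d} * sum_{w in A^{[-n,n]^d}} - mu[w] log mu[w] *)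
Definition entropy (mu : probability X R) : R :=
  limn (fun n : nat =>
    (((n.*2.+1)%:R ^+ d)^-1 *
    \sum_(w : pattern n) (- (fine (mu (cylinder w)) * ln (fine (mu (cylinder w))))) : R)).

(* continuity of phi : X -> R for the product topology *)
Definition cont_potential (phi : X -> R) : Prop :=
  forall (x : X) (e : R), 0 < e -> exists n : nat, forall y : X,
    (forall v, in_box n v -> y v = x v) -> `|phi y - phi x| < e.

Definition var (phi : X -> R) (n : nat) : \bar R :=
  ereal_sup [set r : \bar R | exists x y : X,
     (forall v, in_box n v -> x v = y v) /\ r = (`|phi x - phi y|)%:E].

Definition free_energy (beta : R) (phi : X -> R) (mu : probability X R) : \bar R :=
  ((entropy mu)%:E + beta%:E * \int[mu]_x (phi x)%:E)%E.

Definition ES (beta : R) (phi : X -> R) : set (probability X R) :=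
  [set mu | shift_invariant mu /\
     forall nu : probability X R, shift_invariant nu ->
       (free_energy beta phi nu <= free_energy beta phi mu)%E].

Definition freezing_transition (phi : X -> R) (beta_c : R) : Prop :=
  (forall beta beta', beta_c < beta -> beta_c < beta' ->
      ES beta phi = ES beta' phi) /\
  (forall beta beta', beta < beta_c -> beta_c < beta' ->
      ES beta phi <> ES beta' phi).

End FullShift.

(* Main.v *)
Require Import Defs.
From HB Require Import structures.
From mathcomp Require Import all_boot all_order all_algebra.
From mathcomp Require Import all_classical all_reals all_analysis.
From mathcomp Require Import measurable_realfun ring lra zify.
Import Order.TTheory GRing.Theory Num.Theory.
Import numFieldNormedType.Exports.
Local Open Scope classical_set_scope.
Local Open Scope ring_scope.

(* Let P(beta) be the limit, along an ultrafilter on nat, of the finite-volume pressures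
   ln Z_N(beta) / (2N+1)^d. Gibbs' inequality gives h(nu) + beta * int phi dnu <= P(beta) for every
   invariant nu. Shearer's inequality, applied to the finite-volume Gibbs laws averaged over
   translations, shows that their limit state attains P(beta).
   Write E(m) for the O(m^(d-1)) bound, provided by summable variations, on boundary effects.
   - If on every box the Birkhoff sums of any two patterns differ by at most 3 E(m), then int phi dnu
     is the same for all invariant nu, so ES(beta phi) does not depend on beta at all.
   - Otherwise some box carries patterns p, q such that exchanging p for q in any window changes the
     energy by a definite positive amount, whatever the surroundings. Summing the Cauchy-Schwarz
     inequality Z((b1+b2)/2)^2 <= Z(b1) Z(b2) one window at a time then gains a factor < 1 in each of
     a positive density of disjoint windows, when b2/b1 is large enough. Hence
     2 P((b1+b2)/2) < P(b1) + P(b2), whereas a common equilibrium state of b1 phi and b2 phi forces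
     the opposite inequality, its free energy being affine in beta. *)

Set Implicit Arguments.
Unset Strict Implicit.
Unset Printing Implicit Defensive.

Local Notation shift := Defs.shift.

(** * Entropy of finite partitions and Shearer's inequality *)

(** Boundedness alone gives limits along an ultrafilter, and both halves of the variational
    principle use the same one, so P(beta) is a maximum of free energies whichever ultrafilter finer
    than [\oo] is chosen. Strict convexity is proved for partition functions; an equilibrium state
    enters only through its entropy and its mean. This works because the boundary error of a window
    of radius m does not depend on the size of the surrounding box, so gains in disjoint windows
    multiply. Exchanging p for q changes the energy by an amount known only to lie in an interval
    [D0, D1] of width 6 E(m): one error E(m) comes from the terms based outside the window, and one
    from each pattern when its surroundings are replaced by a fixed background. Three errors explain
    the threshold 3 E(m), which makes D0 positive. The weights at b1 and b2 are then certainly not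
    proportional when b1 D1 < b2 D0, hence the condition on b2/b1. Freezing permits such distant
    parameters, since all beta above the critical value share their equilibrium states. *)

Lemma ln_le_sub1 (R : realType) (x : R) : 0 < x -> ln x <= x - 1.
Proof.
by move=> x0; have := @le_ln1Dx R (x - 1); move=> h; have := h ltac:(lra); rewrite (_ : 1 + (x - 1) = x)//; ring.
Qed.

(** Termwise [ln (q / p) <= q / p - 1], weighted by p. Positivity of q where p is positive keeps
    [ln] away from its default value at 0. *)
Lemma gibbs_inequality (R : realType) (T : finType) (p q : T -> R) :
  (forall t, 0 <= p t) -> (forall t, 0 <= q t) ->
  (forall t, 0 < p t -> 0 < q t) -> \sum_t q t <= \sum_t p t ->
  \sum_t - (p t * ln (p t)) <= - \sum_t p t * ln (q t).
Proof.
move=> p0 q0 pq qp; rewrite -sumrN -subr_le0 -sumrB.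
apply: (@le_trans _ _ (\sum_t (q t - p t))); last by rewrite sumrB subr_le0.
apply: ler_sum => t _.
have [pt0|] := ltP 0 (p t); last first.
  move=> pt; have -> : p t = 0 by apply/le_anti; rewrite pt p0.
  by rewrite !mul0r; have := q0 t; lra.
have qt0 := pq _ pt0.
have := @ln_le_sub1 R (q t / p t) (divr_gt0 qt0 pt0).
rewrite ln_div ?posrE// => /(ler_wpM2l (ltW pt0)).
rewrite !mulrBr mulr1 mulrCA divff ?gt_eqF// mulr1; lra.
Qed.

Section FiniteEntropy.
Variables (R : realType) (W : finType) (G : W -> R).
Hypothesis G_ge0 : forall w, 0 <= G w.

Definition class_weight (e : rel W) (w : W) : R := \sum_(w' | e w w') G w'.

(** For an equivalence relation and a probability G, this is the Shannon entropy of the partition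
    into classes (see [class_entropyE]), written as an expectation over points so that different
    partitions are compared term by term. *)
Definition class_entropy (e : rel W) : R :=
  - \sum_w G w * ln (class_weight e w).

Lemma class_weight_ge0 (e : rel W) (w : W) : 0 <= class_weight e w.
Proof. by apply: sumr_ge0. Qed.

Lemma class_weight_gt0 (e : rel W) (w : W) :
  e w w -> 0 < G w -> 0 < class_weight e w.
Proof.
move=> ew Gw; rewrite /class_weight (bigD1 w)//= ltr_pwDl//.
by apply: sumr_ge0.
Qed.

Lemma class_entropy_le (e e' : rel W) : reflexive e' ->
  (forall w w', e' w w' -> e w w') -> class_entropy e <= class_entropy e'.
Proof.
move=> re' ee'; rewrite lerN2; apply: ler_sum => w _.
have [Gw|] := ltP 0 (G w); last first.
  by move=> Gw; have -> : G w = 0 by [apply/le_anti; rewrite Gw G_ge0]; rewrite !mul0r.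
rewrite ler_wpM2l// ler_ln ?posrE ?class_weight_gt0 ?ee'//.
rewrite /class_weight [leRHS](bigID (e' w))/= -[leLHS]addr0 lerD ?sumr_ge0//.
rewrite le_eqVlt; apply/orP; left; apply/eqP/eq_bigl => w'.
by rewrite andb_idl//; apply: ee'.
Qed.

(* Expanding p1 w * p2 w as a double sum over (w1, w2), the inner sum over w runs over at most one
   class of e12, which is why the total does not exceed the mass of G. *)
Lemma class_entropy_submodular (e12 e1 e2 e0 : rel W) :
  equivalence_rel e1 -> equivalence_rel e2 -> equivalence_rel e0 ->
  (forall w w', e12 w w' = e1 w w' && e2 w w') ->
  (forall w w', e1 w w' -> e0 w w') -> (forall w w', e2 w w' -> e0 w w') ->
  class_entropy e12 + class_entropy e0 <= class_entropy e1 + class_entropy e2.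
Proof.
move=> E1 E2 E0 E12 e10 e20.
have r1 w : e1 w w by case: (E1 w w w).
have r2 w : e2 w w by case: (E2 w w w).
have r0 w : e0 w w by case: (E0 w w w).
have r12 w : e12 w w by rewrite E12 r1 r2.
have s1 w w' : e1 w w' = e1 w' w.
  by apply/idP/idP => h; [have [_ /(_ h) <-] := E1 w w' w | have [_ /(_ h) <-] := E1 w' w w'].
have s2 w w' : e2 w w' = e2 w' w.
  by apply/idP/idP => h; [have [_ /(_ h) <-] := E2 w w' w | have [_ /(_ h) <-] := E2 w' w w'].
have c0 w w' : e0 w w' -> class_weight e0 w = class_weight e0 w'.
  by move=> h; apply: eq_bigl => w''; have [_ /(_ h) ->] := E0 w w' w''.
have c12 w w' : e12 w w' -> class_weight e12 w = class_weight e12 w'.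
  rewrite E12 => /andP[h1 h2]; apply: eq_bigl => w''; rewrite !E12.
  by have [_ /(_ h1) ->] := E1 w w' w''; have [_ /(_ h2) ->] := E2 w w' w''.
set p12 := class_weight e12; set p1 := class_weight e1.
set p2 := class_weight e2; set p0 := class_weight e0.
have p0ge w : 0 <= p0 w := class_weight_ge0 e0 w.
have p12ge w : 0 <= p12 w := class_weight_ge0 e12 w.
(* With [ln t <= t - 1] at [t = p1 p2 / (p12 p0)], submodularity reduces to a bound on total
   mass. *)
suff key : \sum_w G w * (p1 w * p2 w / (p12 w * p0 w)) <= \sum_w G w.
  have : \sum_w G w * (ln (p1 w) + ln (p2 w) - ln (p12 w) - ln (p0 w)) <= 0.
    apply: (@le_trans _ _ (\sum_w (G w * (p1 w * p2 w / (p12 w * p0 w)) - G w))).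
      apply: ler_sum => w _.
      have [Gw|] := ltP 0 (G w); last first.
        by move=> Gw; have -> : G w = 0 by [apply/le_anti; rewrite Gw G_ge0]; rewrite !mul0r; lra.
      have P12 : 0 < p12 w by apply: class_weight_gt0.
      have P1 : 0 < p1 w by apply: class_weight_gt0.
      have P2 : 0 < p2 w by apply: class_weight_gt0.
      have P0 : 0 < p0 w by apply: class_weight_gt0.
      have := @ln_le_sub1 R (p1 w * p2 w / (p12 w * p0 w)) ltac:(by rewrite divr_gt0 ?mulr_gt0).
      rewrite ln_div ?posrE ?mulr_gt0// !lnM ?posrE// => /(ler_wpM2l (G_ge0 w)).
      by lra.
    by rewrite sumrB subr_le0.
  rewrite (eq_bigr (fun w => G w * ln (p1 w) + G w * ln (p2 w) -
    G w * ln (p12 w) - G w * ln (p0 w))); last by move=> w _; ring.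
  by rewrite !sumrB big_split/= /class_entropy; lra.
have -> : \sum_w G w * (p1 w * p2 w / (p12 w * p0 w)) =
    \sum_w1 \sum_w2 G w1 * G w2 * \sum_(w | e1 w w1 && e2 w w2) G w / (p12 w * p0 w).
  under [RHS]eq_bigr => w1 _.
    under eq_bigr => w2 _.
      rewrite mulr_sumr big_mkcond/=.
      over.
    rewrite exchange_big/=.
    over.
  rewrite exchange_big/=; apply: eq_bigr => w _.
  rewrite [p1 w]/class_weight mulr_suml big_mkcond mulr_suml mulr_sumr.
  apply: eq_bigr => w1 _; case: (boolP (e1 w w1)) => h1 /=; last first.
    by rewrite big1 ?mul0r ?mulr0.
  rewrite [p2 w]/class_weight mulr_sumr big_mkcond mulr_suml mulr_sumr.
  apply: eq_bigr => w2 _; case: (boolP (e2 w w2)) => h2 /=; last by rewrite mul0r mulr0.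
  by ring.
(* A point w linked to both w1 and w2 puts them in one class of [e0]. Summing G over the w2 in that
   class then cancels [p0 w1]. *)
apply: (@le_trans _ _ (\sum_w1 \sum_(w2 | e0 w1 w2) G w1 * G w2 / p0 w1)).
  apply: ler_sum => w1 _; rewrite [leRHS]big_mkcond; apply: ler_sum => w2 _.
  case: (pickP (fun w => e1 w w1 && e2 w w2)) => [w /andP[h1 h2]|h]; last first.
    rewrite big_pred0// mulr0; case: ifP => // _.
    by rewrite divr_ge0// mulr_ge0.
  have h01 : e0 w w1 by exact: e10.
  have h02 : e0 w w2 by exact: e20.
  have -> : e0 w1 w2 by have [_ /(_ h01) <-] := E0 w w1 w2.
  rewrite ler_wpM2l ?mulr_ge0//.
  have -> : \sum_(w' | e1 w' w1 && e2 w' w2) G w' / (p12 w' * p0 w') =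
      (\sum_(w' | e12 w w') G w') / p12 w / p0 w1.
    rewrite mulr_suml mulr_suml; apply: eq_big => w'.
      rewrite E12 s1 s2.
      have [_ /(_ h1) ->] := E1 w w1 w'; have [_ /(_ h2) ->] := E2 w w2 w'.
      by [].
    move=> /andP[h1' h2'].
    rewrite (_ : p12 w' = p12 w); last first.
      apply/esym/c12; rewrite E12; apply/andP; split.
        by have [_ /(_ h1) ->] := E1 w w1 w'; rewrite s1.
      by have [_ /(_ h2) ->] := E2 w w2 w'; rewrite s2.
    by rewrite (_ : p0 w' = p0 w1) ?invfM ?mulrA//; apply/c0/e10.
  rewrite ler_piMl ?invr_ge0//; rewrite -/(class_weight e12 w) -/p12.
  have [->|n0] := eqVneq (p12 w) 0; first by rewrite mul0r.
  by rewrite divff.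
apply: ler_sum => w1 _; rewrite -mulr_suml -mulr_sumr.
have [n0|n0] := eqVneq (p0 w1) 0; first by rewrite n0 invr0 mulr0 G_ge0.
by rewrite /p0 /class_weight -mulrA divff ?mulr1.
Qed.

Lemma class_entropyE (T : finType) (Y : W -> T) :
  class_entropy [rel w w' | Y w == Y w'] =
  \sum_t - ((\sum_(w | Y w == t) G w) * ln (\sum_(w | Y w == t) G w)).
Proof.
rewrite /class_entropy (partition_big Y xpredT)//= -sumrN; apply: eq_bigr => t _.
congr (- _); rewrite mulr_suml; apply: eq_bigr => w /eqP Yw.
by congr (_ * ln _); apply: eq_bigl => w'/=; rewrite Yw eq_sym.
Qed.

Section Shearer.
Variables (V : Type) (B : Type) (xi : W -> V -> B).

Definition agree_rel (S : set V) : rel W :=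
  [rel w w' | `[< forall v, S v -> xi w v = xi w' v >]].

Lemma agree_rel_equiv (S : set V) : equivalence_rel (agree_rel S).
Proof.
move=> w1 w2 w3; split; first exact/asboolP.
move=> /asboolP h; apply/asboolP/asboolP => h' v Sv.
  by rewrite -(h v Sv); apply: h'.
by rewrite (h v Sv); apply: h'.
Qed.

(** Joint entropy of the coordinates in S when w is drawn with weights G. *)
Definition set_entropy (S : set V) : R := class_entropy (agree_rel S).

Lemma agree_rel_sub (S S' : set V) : S `<=` S' ->
  forall w w', agree_rel S' w w' -> agree_rel S w w'.
Proof. by move=> SS w w' /asboolP h; apply/asboolP => v /SS; apply: h. Qed.

Lemma set_entropy_le (S S' : set V) : S `<=` S' ->
  set_entropy S <= set_entropy S'.
Proof.
move=> SS; apply: class_entropy_le; first by move=> w; apply/asboolP.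
exact: agree_rel_sub.
Qed.

Lemma set_entropy_submodular (S S' : set V) :
  set_entropy (S `|` S') + set_entropy (S `&` S') <=
  set_entropy S + set_entropy S'.
Proof.
apply: class_entropy_submodular; try exact: agree_rel_equiv.
- move=> w w'; apply/asboolP/andP.
    by move=> h; split; apply/asboolP => v Sv; apply: h; [left|right].
  by move=> [/asboolP h1 /asboolP h2] v [/h1|/h2].
- by apply: agree_rel_sub; apply: subIsetl.
- by apply: agree_rel_sub; apply: subIsetr.
Qed.

(** Reveal the coordinates one at a time. By submodularity, the entropy added by [b t] is at most
    what it adds inside any [F j] containing it, and at least k of these sets do. *)
Lemma shearer (T J : finType) (b : T -> V) (F : J -> set V) (k : nat) :
  \sum_w G w = 1 ->
  (forall t, (k <= #|[pred j | `[< F j (b t) >]]|)%N) ->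
  set_entropy (range b) *+ k <= \sum_j set_entropy (F j).
Proof.
move=> G_sum1 cov.
pose S (s : seq T) := [set v | exists2 t, t \in s & v = b t].
have main (s : seq T) : set_entropy (S s) *+ k - set_entropy set0 *+ k <=
    \sum_j (set_entropy (F j `&` S s) - set_entropy set0).
  elim: s => [|t s IH].
    have -> : S [::] = set0 by rewrite -subset0 => v [].
    by rewrite subrr big1// => j _; rewrite setI0 subrr.
  have SsE : S (t :: s) = S s `|` [set b t].
    apply/seteqP; split => v.
      by move=> [t']; rewrite inE => /predU1P[->|ts] ->; [right|left; exists t'].
    move=> [[t' ts ->]|->]; first by exists t' => //; rewrite inE ts orbT.
    by exists t => //; rewrite inE eqxx.
  have le1 : set_entropy (S s) <= set_entropy (S (t :: s)).
    by apply: set_entropy_le; rewrite SsE.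
  apply: (@le_trans _ _ ((\sum_j (set_entropy (F j `&` S s) - set_entropy set0)) +
    \sum_(j | `[< F j (b t) >]) (set_entropy (S (t :: s)) - set_entropy (S s)))).
    rewrite sumr_const; set n := (X in _ + _ *+ X).
    have kn : (k <= n)%N by exact: cov t.
    have : (set_entropy (S (t :: s)) - set_entropy (S s)) *+ k <=
      (set_entropy (S (t :: s)) - set_entropy (S s)) *+ n.
      by rewrite -(subnKC kn) mulrnDr lerDl mulrn_wge0// subr_ge0.
    by rewrite mulrnBl; lra.
  rewrite [X in _ + X]big_mkcond/= -big_split/=; apply: ler_sum => j _.
  case: ifPn => [/asboolP Fj|Fj]; last first.
    by rewrite addr0 lerD2r; apply: set_entropy_le; apply: setIS; rewrite SsE.
  have := set_entropy_submodular (F j `&` S (t :: s)) (S s).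
  have -> : F j `&` S (t :: s) `|` S s = S (t :: s).
    rewrite SsE; apply/seteqP; split => v; first by move=> [[]//|]; left.
    by move=> [Sv|->]; [right|left; split => //; right].
  have -> : F j `&` S (t :: s) `&` S s = F j `&` S s.
    by rewrite -setIA; congr (_ `&` _); apply/setIidPr; rewrite SsE.
  by lra.
have Srange : S (enum T) = range b.
  apply/seteqP; split => v; first by move=> [t _ ->]; exists t.
  by move=> [t _ <-]; exists t => //; rewrite mem_enum.
(* Without coordinates there is a single class, of weight 1, and [ln 1 = 0]. *)
have H0 : set_entropy set0 = 0.
  rewrite /set_entropy /class_entropy big1 ?oppr0// => w _.
  rewrite (_ : class_weight _ _ = 1) ?ln1 ?mulr0// -G_sum1.
  by apply: eq_bigl => w'; apply/asboolP.
have := main (enum T); rewrite H0 mul0rn subr0 Srange => /le_trans; apply.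
apply: ler_sum => j _; rewrite subr0; apply: set_entropy_le.
exact: subIsetl.
Qed.

End Shearer.
End FiniteEntropy.

(** * Boxes in Z^d *)

Section Sites.
Variable d : nat.
Implicit Types u v w : site d.

Definition box (n : nat) := {ffun 'I_d -> 'I_(n.*2.+1)}.
Definition add_site u v : site d := fun i => u i + v i.
Definition sub_site u v : site d := fun i => u i - v i.
Definition norm_site v : nat := \max_(i < d) `|v i|%N.
(** Inverse of [box_site] on the box of radius n; the values at other sites carry no meaning. *)
Definition unbox n v : box n := [ffun i => inord (absz (v i + n%:Z))].

Lemma in_boxP n v : in_box n v <-> (norm_site v <= n)%N.
Proof.
split=> [h|/bigmax_leqP h i]; first by apply/bigmax_leqP => i _; have := h i; lia.
by have := h i isT; lia.
Qed.

Lemma coord_le_norm v i : (`|v i| <= norm_site v)%N.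
Proof. exact: (leq_bigmax i). Qed.

Lemma norm_add_site u v : (norm_site (add_site u v) <= norm_site u + norm_site v)%N.
Proof.
apply/bigmax_leqP => i _; rewrite /add_site.
by have := coord_le_norm u i; have := coord_le_norm v i; lia.
Qed.

Lemma norm_sub_site u v : (norm_site (sub_site u v) <= norm_site u + norm_site v)%N.
Proof.
apply/bigmax_leqP => i _; rewrite /sub_site.
by have := coord_le_norm u i; have := coord_le_norm v i; lia.
Qed.

Lemma add_siteK u v : sub_site (add_site v u) u = v.
Proof. by apply/funext => i; rewrite /sub_site /add_site addrK. Qed.

Lemma sub_siteK u v : add_site (sub_site v u) u = v.
Proof. by apply/funext => i; rewrite /sub_site /add_site subrK. Qed.

Lemma norm_box_site n (p : box n) : (norm_site (box_site p) <= n)%N.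
Proof.
by apply/bigmax_leqP => i _; rewrite /box_site; have := ltn_ord (p i); lia.
Qed.

Lemma box_siteK n : cancel (@box_site d n) (unbox n).
Proof.
move=> p; apply/ffunP => i; rewrite ffunE; apply/val_inj => /=.
have h : absz (box_site p i + n%:Z) = p i :> nat by rewrite /box_site; lia.
by rewrite h inordK.
Qed.

Lemma box_site_inj n : injective (@box_site d n).
Proof. exact: can_inj (@box_siteK n). Qed.

Lemma unboxK n v : (norm_site v <= n)%N -> box_site (unbox n v) = v.
Proof.
move=> vn; apply/funext => i; rewrite /box_site ffunE.
have := coord_le_norm v i => h.
by rewrite inordK; lia.
Qed.

Lemma card_box n : #|{: box n}| = (n.*2.+1 ^ d)%N.
Proof. by rewrite card_ffun !card_ord. Qed.

Lemma expn_diff_le (a b : nat) : (b <= a)%N ->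
  (a ^ d - b ^ d <= d * (a - b) * a ^ d.-1)%N.
Proof.
move=> ba; elim: d => [|e IH]; first by rewrite !expn0 subnn.
rewrite !expnS /=.
case: e IH => [|e] IH; first by rewrite !expn0; lia.
rewrite /= in IH.
have : (b ^ e.+1 <= a ^ e.+1)%N by rewrite leq_exp2r.
have : (a ^ e.+1 = a * a ^ e)%N by rewrite expnS.
have : (a * (a ^ e.+1 - b ^ e.+1) <= a * (e.+1 * (a - b) * a ^ e))%N by rewrite leq_mul2l IH orbT.
move: (a ^ e.+1)%N (b ^ e.+1)%N (a ^ e)%N => A B C.
nia.
Qed.

(** The sphere avoids the embedded box of radius one less, so its size is at most a difference of
    two d-th powers whose bases differ by 2. At radius 0 the bound needs d > 0. *)
Lemma card_shell_box n : (0 < d)%N ->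
  (#|[set c : box n | norm_site (box_site c) == n]%SET| <= 2 * d * n.*2.+1 ^ d.-1)%N.
Proof.
move=> d0; case: n => [|n].
  apply: leq_trans (max_card _) _; rewrite card_box double0 !exp1n; lia.
set B := (X in #|pred_of_set X|).
have imB : (fun c : box n => unbox n.+1 (box_site c)) @: {: box n} \subset ~: B.
  apply/fintype.subsetP => c /imsetP[c' _ ->]; rewrite !inE.
  have := norm_box_site c' => h; rewrite unboxK; first by rewrite neq_ltn ltnS h.
  exact: leq_trans h _.
have := subset_leq_card imB; rewrite card_imset; last first.
  move=> c c' /(congr1 (@box_site d n.+1)).
  have h p : (norm_site (@box_site d n p) <= n.+1)%N by exact: leq_trans (norm_box_site p) _.
  by rewrite !unboxK//; apply: box_site_inj.
rewrite card_box => h; have := cardsC B; rewrite card_box => hB.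
have := @expn_diff_le n.+1.*2.+1 n.*2.+1 ltac:(lia).
have -> : (n.+1.*2.+1 - n.*2.+1 = 2)%N by lia.
rewrite (mulnC d 2); move: (n.+1.*2.+1 ^ d.-1)%N (n.+1.*2.+1 ^ d)%N (n.*2.+1 ^ d)%N hB h => A B' C.
lia.
Qed.

Lemma card_shell (T : finType) (s : T -> site d) (r : nat) : (0 < d)%N -> injective s ->
  (#|[pred t | norm_site (s t) == r]| <= 2 * d * r.*2.+1 ^ d.-1)%N.
Proof.
move=> d0 sinj; apply: leq_trans (card_shell_box r d0); rewrite -cardsE.
rewrite -(card_in_imset (f := fun t => unbox r (s t))); last first.
  move=> t t'; rewrite !inE => /eqP h /eqP h' /(congr1 (@box_site d r)).
  by rewrite !unboxK ?h ?h'//; apply: sinj.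
apply: subset_leq_card; apply/fintype.subsetP => c /imsetP[t].
by rewrite !inE => /eqP h ->; rewrite unboxK ?h.
Qed.

Section ShellSums.
Variable R : realType.

Lemma sum_by_norm (T : finType) (s : T -> site d) (g : nat -> R) (M : nat) :
  (0 < d)%N -> injective s -> (forall r, 0 <= g r) -> (forall t, (norm_site (s t) < M)%N) ->
  \sum_t g (norm_site (s t)) <= \sum_(r < M) (2 * d * r.*2.+1 ^ d.-1)%:R * g r.
Proof.
move=> d0 sinj g0 sM.
rewrite (partition_big (fun t => Ordinal (sM t)) xpredT)//=; apply: ler_sum => r _.
rewrite (eq_bigr (fun=> g r)); last by move=> t /eqP <-.
rewrite sumr_const -[leLHS]mulr_natl ler_wpM2r// ler_nat.
exact: card_shell.
Qed.

Variables (v : nat -> R) (C : R).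
Hypothesis d_gt0 : (0 < d)%N.
Hypothesis v_ge0 : forall k, 0 <= v k.
Hypothesis v_sum : forall n, \sum_(k < n) (k.+1 ^ d.-1)%:R * v k <= C.

(** A surface term of order m^(d-1). The factor 2d comes from [card_shell], and 3^(d-1) from
    [2 (m + 1 + k) + 1 <= 3 (2 m + 1) (k + 1)], which separates the window radius m from the
    distance k to it. *)
Definition shell_bound (m : nat) : R := (2 * d * 3 ^ d.-1 * m.*2.+1 ^ d.-1)%:R * C.

(** Total influence of a window of radius m on terms based outside it: seen from a site of norm r >
    m, configurations that differ only in the window agree up to radius r - m - 1. Summing by k = r
    - m - 1 produces exactly the weights (k+1)^(d-1). *)
Lemma sum_outer_shells (T : finType) (s : T -> site d) (m : nat) : injective s ->
  \sum_(t | (m < norm_site (s t))%N) v (norm_site (s t) - m.+1) <= shell_bound m.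
Proof.
move=> sinj.
pose M := (\max_t norm_site (s t)).+1.
pose g r := if (m < r)%N then v (r - m.+1) else 0.
rewrite big_mkcond/=.
apply: (le_trans (@sum_by_norm T s g (m.+1 + M) d_gt0 sinj _ _)).
- by move=> r; rewrite /g; case: ifP.
- by move=> t; rewrite (leq_trans _ (leq_addl _ _))// ltnS (leq_bigmax t).
rewrite big_split_ord/= big1 ?add0r; last first.
  by move=> r _; rewrite /g ltnNge -ltnS ltn_ord/= mulr0.
apply: (@le_trans _ _ (\sum_(k < M) (2 * d * 3 ^ d.-1 * m.*2.+1 ^ d.-1)%:R * ((k.+1 ^ d.-1)%:R * v k))).
  apply: ler_sum => k _; rewrite /g.
  have -> : (m < m.+1 + k)%N by lia.
  have -> : (m.+1 + k - m.+1 = k)%N by lia.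
  rewrite mulrA ler_wpM2r// -natrM ler_nat -!mulnA !leq_mul2l; apply/orP; right; apply/orP; right.
  rewrite -!expnMn; case: (d.-1) => [|e]; first by rewrite !expn0.
  rewrite leq_exp2r//; nia.
by rewrite -mulr_sumr ler_wpM2l.
Qed.

(** Total influence of the exterior on terms based in the box: a site of norm r sees only the box up
    to radius m - r, and every shell has at most the size of the outermost bound. *)
Lemma sum_inner_shells (m : nat) :
  \sum_(c : box m) v (m - norm_site (box_site c)) <= shell_bound m.
Proof.
apply: (le_trans (@sum_by_norm (box m) (@box_site d m) (fun r => v (m - r)) m.+1 d_gt0
  (@box_site_inj m) _ _)) => //.
  by move=> t; rewrite ltnS norm_box_site.
apply: (@le_trans _ _ (\sum_(k < m.+1) (2 * d * 3 ^ d.-1 * m.*2.+1 ^ d.-1)%:R * ((k.+1 ^ d.-1)%:R * v k))).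
  rewrite (reindex_inj rev_ord_inj)/=; apply: ler_sum => k _.
  have -> : (m - (m.+1 - k.+1) = k)%N by have := ltn_ord k; lia.
  rewrite mulrA ler_wpM2r// -natrM ler_nat -!mulnA !leq_mul2l; apply/orP; right; apply/orP; right.
  apply: (@leq_trans (m.*2.+1 ^ d.-1)).
    by case: (d.-1) => [|e]; rewrite ?expn0// leq_exp2r//; lia.
  by rewrite mulnCA leq_pmulr// muln_gt0 !expn_gt0.
by rewrite -mulr_sumr ler_wpM2l.
Qed.

End ShellSums.
End Sites.

(** * Configurations and Birkhoff sums *)

Section Configurations.
Variables (d : nat) (A : finType) (a0 : A).
Implicit Types x y : X d a0.

Definition agree (n : nat) x y : Prop :=
  forall v, (norm_site v <= n)%N -> x v = y v.

Definition restr (n : nat) x : pattern d A n := [ffun p => x (box_site p)].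

(** Places the pattern in the constant background [a0]. By [birkhoff_agree], any other background
    changes the Birkhoff sum of the box by at most a surface term. *)
Definition ext (n : nat) (w : pattern d A n) : X d a0 :=
  fun v => if (norm_site v <= n)%N then w (unbox n v) else a0.

Lemma ext_box_site (n : nat) (w : pattern d A n) p : ext w (box_site p) = w p.
Proof. by rewrite /ext norm_box_site box_siteK. Qed.

Lemma extK (n : nat) : cancel (@ext n) (restr n).
Proof. by move=> w; apply/ffunP => p; rewrite ffunE ext_box_site. Qed.

Lemma restr_eqP (n : nat) x y : restr n x = restr n y <-> agree n x y.
Proof.
split=> [h v vn|h]; last by apply/ffunP => p; rewrite !ffunE h// norm_box_site.
by have := congr1 (fun w : pattern d A n => w (unbox n v)) h; rewrite !ffunE unboxK.
Qed.

Lemma agree_ext_restr (n : nat) x : agree n (ext (restr n x)) x.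
Proof. by apply/restr_eqP; rewrite extK. Qed.

Lemma cylinderE (n : nat) (w : pattern d A n) : cylinder (a0 := a0) w = [set x | restr n x = w].
Proof.
apply/seteqP; split => x /= h; first by apply/ffunP => p; rewrite ffunE; exact: h.
by move=> p; rewrite -h ffunE.
Qed.

Lemma agree_sym (n : nat) x y : agree n x y -> agree n y x.
Proof. by move=> h v vn; rewrite h. Qed.

Lemma agree_le (m n : nat) x y : (m <= n)%N -> agree n x y -> agree m x y.
Proof. by move=> mn h v vm; apply: h; apply: leq_trans mn. Qed.

Lemma shift_add (u w : site d) x : shift u (shift w x) = shift (add_site u w) x.
Proof. by apply/funext => v; congr x; apply/funext => i; rewrite /add_site addrA. Qed.

Lemma agree_shift (m n : nat) (u : site d) x y : (m + norm_site u <= n)%N ->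
  agree n x y -> agree m (shift u x) (shift u y).
Proof.
move=> mn h v vm; apply: h; apply: leq_trans (norm_add_site v u) _.
by apply: leq_trans mn; rewrite leq_add2r.
Qed.

Section Birkhoff.
Variables (R : realType) (phi : X d a0 -> R) (v : nat -> R) (C : R).
Hypothesis d_gt0 : (0 < d)%N.
Hypothesis v_ge0 : forall k, 0 <= v k.
Hypothesis v_sum : forall n, \sum_(k < n) (k.+1 ^ d.-1)%:R * v k <= C.
Hypothesis v_var : forall k x y, agree k x y -> `|phi x - phi y| <= v k.

Definition birkhoff (N : nat) x : R := \sum_(c : box d N) phi (shift (box_site c) x).

Lemma birkhoff_agree (N : nat) x y : agree N x y ->
  `|birkhoff N x - birkhoff N y| <= shell_bound d C N.
Proof.
move=> h; rewrite -sumrB; apply: le_trans (ler_norm_sum _ _ _) _.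
apply: le_trans (sum_inner_shells d_gt0 v_ge0 v_sum N); apply: ler_sum => c _.
by apply/v_var/(agree_shift _ h); rewrite subnK// norm_box_site.
Qed.

(** The terms based in the window are, after reindexing, the Birkhoff sums of the box of radius m.
    The others are controlled by [sum_outer_shells], whose bound is uniform in N. *)
Lemma birkhoff_local_change (N m : nat) (u : site d) x y : (norm_site u + m <= N)%N ->
  (forall w, (m < norm_site (sub_site w u))%N -> x w = y w) ->
  `|(birkhoff N x - birkhoff N y) - (birkhoff m (shift u x) - birkhoff m (shift u y))|
    <= shell_bound d C m.
Proof.
move=> uN h; rewrite -!sumrB.
pose s (c : box d N) := sub_site (box_site c) u.
have sinj : injective s.
  by move=> c c' e; apply: (@box_site_inj d N); rewrite -[LHS](sub_siteK u) -[RHS](sub_siteK u) -/(s c) -/(s c') e.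
have -> : \sum_(c : box d m) (phi (shift (box_site c) (shift u x)) - phi (shift (box_site c) (shift u y)))
   = \sum_(c : box d N | (norm_site (s c) <= m)%N) (phi (shift (box_site c) x) - phi (shift (box_site c) y)).
  rewrite (reindex_onto (fun c : box d m => unbox N (add_site (box_site c) u))
     (fun c : box d N => unbox m (s c))); last first.
    move=> c cm; rewrite unboxK//; apply: (@box_site_inj d N).
    by rewrite unboxK /s sub_siteK// norm_box_site.
  have uc (c : box d m) : box_site (unbox N (add_site (box_site c) u)) = add_site (box_site c) u.
    rewrite unboxK//; apply: leq_trans (norm_add_site _ _) _.
    by have := norm_box_site c; lia.
  apply: eq_big => [c|c _]; last by rewrite !shift_add uc.
  by rewrite /s uc add_siteK norm_box_site box_siteK eqxx.
rewrite (bigID (fun c => (norm_site (s c) <= m)%N))/= [X in `|X - _|]addrC addrK.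
apply: le_trans (ler_norm_sum _ _ _) _.
apply: le_trans (sum_outer_shells d_gt0 v_ge0 v_sum m sinj).
under eq_bigl do rewrite -ltnNge.
apply: ler_sum => c cm; apply: v_var => w wc; apply: h.
have := norm_sub_site (sub_site (add_site w (box_site c)) u) w.
have -> : sub_site (sub_site (add_site w (box_site c)) u) w = s c.
  by apply/funext => i; rewrite /s /sub_site /add_site; ring.
rewrite /add_site; move: (norm_site (s c)) cm wc => k; lia.
Qed.

End Birkhoff.
End Configurations.

(** * A gain in the Cauchy-Schwarz inequality *)

Section OneStep.
Variable R : realType.

Lemma sumr_constT (T : finType) (x : R) : \sum_(t : T) x = #|T|%:R * x.
Proof. by rewrite mulr_natl -sumr_const; apply: eq_bigl. Qed.

(** Lagrange's identity writes the Cauchy-Schwarz defect as half the sum of all squared 2 x 2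
    minors; only the minor of p and q, which occurs twice, is kept. *)
Lemma cauchy_schwarz_pair (T : finType) (a b : T -> R) (p q : T) :
  (\sum_t a t * b t) ^+ 2 + (a p * b q - a q * b p) ^+ 2 <=
  (\sum_t a t ^+ 2) * (\sum_t b t ^+ 2).
Proof.
pose D i j := (a i * b j - a j * b i) ^+ 2.
have lagrange : \sum_i \sum_j D i j =
    ((\sum_t a t ^+ 2) * (\sum_t b t ^+ 2) - (\sum_t a t * b t) ^+ 2) *+ 2.
  transitivity (\sum_i \sum_j (a i ^+ 2 * b j ^+ 2 + b i ^+ 2 * a j ^+ 2
      - ((a i * b i) * (a j * b j)) *+ 2)).
    by apply: eq_bigr => i _; apply: eq_bigr => j _; rewrite /D; ring.
  have e (f g : T -> R) : \sum_i \sum_j f i * g j = (\sum_i f i) * (\sum_j g j).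
    by rewrite mulr_suml; apply: eq_bigr => i _; rewrite mulr_sumr.
  under eq_bigr do rewrite sumrB big_split/= sumrMnl.
  rewrite sumrB big_split/= sumrMnl !e.
  by ring.
have D0 i j : 0 <= D i j by exact: sqr_ge0.
have [pq|pq] := eqVneq p q.
  rewrite pq subrr expr0n addr0.
  have : 0 <= \sum_i \sum_j D i j by apply: sumr_ge0 => i _; apply: sumr_ge0.
  by rewrite lagrange; lra.
have : D p q + D q p <= \sum_i \sum_j D i j.
  apply: (@le_trans _ _ (\sum_j D p j + \sum_j D q j)).
    have le1 i j : D i j <= \sum_k D i k by rewrite (bigD1 j)//= lerDl sumr_ge0.
    exact: lerD.
  rewrite [leRHS](bigD1 p)//= lerD2l [leRHS](bigD1 q) 1?eq_sym//= lerDl.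
  by apply: sumr_ge0 => i _; apply: sumr_ge0.
rewrite lagrange /D -(opprB (a p * b q)) sqrrN.
lra.
Qed.

Lemma cauchy_schwarz_sqrt (T : finType) (F G : T -> R) :
  (forall t, 0 < F t) -> (forall t, 0 < G t) ->
  (\sum_t Num.sqrt (F t * G t)) ^+ 2 <= (\sum_t F t) * (\sum_t G t).
Proof.
move=> F0 G0.
have [p _|T0] := pickP (fun _ : T => true); last by rewrite !big_pred0// expr0n/= mul0r.
have := @cauchy_schwarz_pair T (fun t => Num.sqrt (F t)) (fun t => Num.sqrt (G t)) p p.
have sq (H : T -> R) : (forall t, 0 < H t) -> \sum_t Num.sqrt (H t) ^+ 2 = \sum_t H t.
  by move=> H0; apply: eq_bigr => t _; rewrite sqr_sqrtr// ltW.
rewrite !sq// subrr expr0n addr0.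
by under eq_bigr do rewrite -sqrtrM ?(ltW (F0 _))//.
Qed.

(** The ratios of p to q under F and under G are separated by a < b, so the minor of p and q is at
    least [(sqrt b - sqrt a) * sqrt (F q * G q)]. The bounds by c make [F q * G q] a definite
    fraction of the product of the sums. *)
Lemma hoelder_gain (T : finType) (F G : T -> R) (p q : T) (a b c : R) :
  (forall t, 0 < F t) -> (forall t, 0 < G t) ->
  0 < a -> a < b -> 0 < c ->
  F p <= a * F q -> b * G q <= G p ->
  (forall t, F t <= c * F q) -> (forall t, G t <= c * G q) ->
  (\sum_t Num.sqrt (F t * G t)) ^+ 2 <=
  (1 - (Num.sqrt b - Num.sqrt a) ^+ 2 / (c * #|T|%:R) ^+ 2) * ((\sum_t F t) * (\sum_t G t)).
Proof.
move=> F0 G0 a0 ab c0 Fpq Gpq Fc Gc.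
have b0 : 0 < b by exact: lt_trans ab.
have pq : p != q.
  apply/eqP => pq; rewrite pq in Fpq Gpq.
  have : b * G q * F q <= a * F q * G q.
    apply: (@le_trans _ _ (G q * F q)); first by rewrite ler_wpM2r// ltW.
    by rewrite mulrC ler_wpM2r// ltW.
  rewrite -!mulrA [G q * _]mulrC ler_pM2r ?mulr_gt0//; lra.
have := @cauchy_schwarz_pair T (fun t => Num.sqrt (F t)) (fun t => Num.sqrt (G t)) p q.
have sq (H : T -> R) : (forall t, 0 < H t) -> \sum_t Num.sqrt (H t) ^+ 2 = \sum_t H t.
  by move=> H0; apply: eq_bigr => t _; rewrite sqr_sqrtr// ltW.
rewrite !sq//.
under eq_bigr do rewrite -sqrtrM ?(ltW (F0 _))//.
set SF := \sum_t F t; set SG := \sum_t G t; set P := _ ^+ 2.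
set sa := Num.sqrt a; set sb := Num.sqrt b; set Q := _ ^+ 2 => h.
suff : (sb - sa) ^+ 2 / (c * #|T|%:R) ^+ 2 * (SF * SG) <= Q by rewrite mulrBl mul1r; lra.
have sab : 0 <= sb - sa by rewrite subr_ge0 ler_sqrt ltW.
have n0 : 0 < #|T|%:R :> R by rewrite ltr0n; apply/card_gt0P; exists p.
have sumle (H : T -> R) M : (forall t, H t <= c * M) -> \sum_t H t <= c * #|T|%:R * M.
  move=> HM; apply: le_trans (ler_sum _ (fun t _ => HM t)) _.
  by rewrite sumr_constT mulrCA mulrA.
have SFle : SF <= c * #|T|%:R * F q by exact: sumle.
have SGle : SG <= c * #|T|%:R * G q by exact: sumle.
have SF0 : 0 <= SF by apply: sumr_ge0 => t _; exact: ltW.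
have SG0 : 0 <= SG by apply: sumr_ge0 => t _; exact: ltW.
apply: (@le_trans _ _ ((sb - sa) ^+ 2 * (F q * G q))).
  rewrite -mulrA ler_wpM2l ?sqr_ge0// mulrC ler_pdivrMr ?exprn_gt0 ?mulr_gt0//.
  apply: le_trans (ler_pM SF0 SG0 SFle SGle) _.
  by rewrite le_eqVlt; apply/orP; left; apply/eqP; ring.
have key : (sb - sa) * (Num.sqrt (F q) * Num.sqrt (G q)) <=
    Num.sqrt (F q) * Num.sqrt (G p) - Num.sqrt (F p) * Num.sqrt (G q).
  have e1 : Num.sqrt (F p) <= sa * Num.sqrt (F q).
    by rewrite /sa -sqrtrM ?(ltW a0)// ler_wsqrtr.
  have e2 : sb * Num.sqrt (G q) <= Num.sqrt (G p).
    by rewrite /sb -sqrtrM ?(ltW b0)// ler_wsqrtr.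
  have := ler_wpM2l (sqrtr_ge0 (F q)) e2; have := ler_wpM2r (sqrtr_ge0 (G q)) e1.
  lra.
have low : 0 <= (sb - sa) * (Num.sqrt (F q) * Num.sqrt (G q)).
  by rewrite mulr_ge0// mulr_ge0 ?sqrtr_ge0.
rewrite /Q -(opprB (_ * _)) sqrrN.
have -> : (sb - sa) ^+ 2 * (F q * G q) = ((sb - sa) * (Num.sqrt (F q) * Num.sqrt (G q))) ^+ 2.
  by rewrite !exprMn !sqr_sqrtr// ltW.
by rewrite ler_sqr ?nnegrE// (le_trans low).
Qed.

End OneStep.

(** * Accumulating the gain over disjoint windows *)

Section Windows.
Variables (R : realType) (W P : finType) (K : nat).
Variables (repl : nat -> P -> W -> W) (read : nat -> W -> P).
Hypothesis replK : forall j p w, (j < K)%N -> repl j (read j w) (repl j p w) = w.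
Hypothesis read_repl : forall j p w, (j < K)%N -> read j (repl j p w) = p.
Hypothesis replC : forall (i j : nat) p q w, (i < K)%N -> (j < K)%N -> i != j -> repl i p (repl j q w) = repl j q (repl i p w).

(** Swapping the content of window j with an external pattern is an involution of [W * P]. *)
Lemma sum_repl (h : W -> R) (j : nat) : (j < K)%N ->
  \sum_w \sum_p h (repl j p w) = #|P|%:R * \sum_w h w.
Proof.
move=> jK; rewrite pair_bigA/=.
pose f (x : W * P) := (repl j x.2 x.1, read j x.1).
have fK : involutive f by move=> [w p]; rewrite /f/= replK ?read_repl.
rewrite (reindex_inj (inv_inj fK))/=.
under eq_bigr => x _ do rewrite replK//.
rewrite -(pair_bigA _ (fun w _ => h w))/= mulr_sumr; apply: eq_bigr => w _.
by rewrite sumr_constT.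
Qed.

(* [marginal F k w] sums F over all contents of the windows 0, ..., k - 1. It inherits by linearity
   the ratio bounds of F in the windows that are still to come. *)
Fixpoint marginal (F : W -> R) (k : nat) : W -> R :=
  if k is k'.+1 then fun w => \sum_p marginal F k' (repl k' p w) else F.

Lemma marginal_gt0 (F : W -> R) (p0 : P) k : (forall w, 0 < F w) ->
  forall w, 0 < marginal F k w.
Proof.
move=> F0; elim: k => [|k IH] w //=.
by rewrite (bigD1 p0)//= ltr_pwDl// sumr_ge0// => p _; exact: ltW.
Qed.

Lemma marginal_le (F : W -> R) (p q : P) (c : R) :
  (forall j w, (j < K)%N -> F (repl j p w) <= c * F (repl j q w)) ->
  forall k j w, (k <= j < K)%N -> marginal F k (repl j p w) <= c * marginal F k (repl j q w).
Proof.
move=> h; elim=> [|k IH] j w /andP[kj jK] /=; first exact: h.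
rewrite mulr_sumr; apply: ler_sum => r _.
have kj' : k != j by rewrite neq_ltn kj.
have kK : (k < K)%N by exact: ltn_trans jK.
by rewrite 2!(replC _ _ _ kK jK kj'); apply: IH; rewrite jK (ltnW kj).
Qed.

Lemma le_marginal (F : W -> R) (p q : P) (c : R) :
  (forall j w, (j < K)%N -> c * F (repl j q w) <= F (repl j p w)) ->
  forall k j w, (k <= j < K)%N -> c * marginal F k (repl j q w) <= marginal F k (repl j p w).
Proof.
move=> h; elim=> [|k IH] j w /andP[kj jK] /=; first exact: h.
rewrite mulr_sumr; apply: ler_sum => r _.
have kj' : k != j by rewrite neq_ltn kj.
have kK : (k < K)%N by exact: ltn_trans jK.
by rewrite 2!(replC _ _ _ kK jK kj'); apply: IH; rewrite jK (ltnW kj).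
Qed.

Lemma sum_marginal (F : W -> R) k : (k <= K)%N ->
  \sum_w marginal F k w = #|P|%:R ^+ k * \sum_w F w.
Proof.
by elim: k => [|k IH] kK; rewrite ?mul1r//= sum_repl// IH ?exprS ?mulrA// ltnW.
Qed.

(** Each window summed out costs a factor [sqrt D] in the sum of [sqrt (F G)]; after the last one,
    plain Cauchy-Schwarz finishes. Marginals remain functions on all of W, so powers of [#|P|]
    appear on both sides and cancel. *)
Lemma hoelder_gain_windows (F G : W -> R) (p q : P) (a b c : R) :
  (forall w, 0 < F w) -> (forall w, 0 < G w) -> 0 < a -> a < b -> 0 < c ->
  (forall j w, (j < K)%N -> F (repl j p w) <= a * F (repl j q w)) ->
  (forall j w, (j < K)%N -> b * G (repl j q w) <= G (repl j p w)) ->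
  (forall j w r, (j < K)%N -> F (repl j r w) <= c * F (repl j q w)) ->
  (forall j w r, (j < K)%N -> G (repl j r w) <= c * G (repl j q w)) ->
  (\sum_w Num.sqrt (F w * G w)) ^+ 2 <=
  (1 - (Num.sqrt b - Num.sqrt a) ^+ 2 / (c * #|P|%:R) ^+ 2) ^+ K *
    ((\sum_w F w) * (\sum_w G w)).
Proof.
move=> F0 G0 a0 ab c0 Fpq Gpq Fc Gc.
set D := 1 - _ / _.
have P0 : 0 < #|P|%:R :> R by rewrite ltr0n; apply/card_gt0P; exists p.
have MF0 := fun k => @marginal_gt0 F p k F0.
have MG0 := fun k => @marginal_gt0 G p k G0.
have step k w : (k < K)%N -> (\sum_r Num.sqrt (marginal F k (repl k r w) * marginal G k (repl k r w))) ^+ 2 <=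
    D * (marginal F k.+1 w * marginal G k.+1 w).
  move=> kK; apply: (@hoelder_gain R P _ _ p q) => //.
  - by apply: (marginal_le Fpq); rewrite leqnn.
  - by apply: (le_marginal Gpq); rewrite leqnn.
  - by move=> t; apply: (@marginal_le F t q c); rewrite ?leqnn// => j w' jK; exact: Fc.
  - by move=> t; apply: (@marginal_le G t q c); rewrite ?leqnn// => j w' jK; exact: Gc.
pose s k := \sum_w Num.sqrt (marginal F k w * marginal G k w).
have s_ge0 k : 0 <= s k by apply: sumr_ge0 => w _; exact: sqrtr_ge0.
(* Nonnegativity of D is read off from the gain in window 0, which requires a window and a point of
   W; the degenerate cases are settled separately. *)
case: (posnP K) => [K0|K0].
  have -> : D ^+ K = 1 by rewrite K0 expr0.
  by rewrite mul1r; exact: cauchy_schwarz_sqrt.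
have [w0 _|W0] := pickP (fun _ : W => true); last by rewrite !big_pred0// expr0n/= mul0r mulr0.
have D0 : 0 <= D.
  have := le_trans (sqr_ge0 _) (step 0 w0 K0).
  by rewrite pmulr_lge0// mulr_gt0.
have sS k : (k < K)%N -> #|P|%:R * s k <= Num.sqrt D * s k.+1.
  move=> kK; rewrite -(sum_repl _ kK) mulr_sumr; apply: ler_sum => w _.
  rewrite -sqrtrM// -[leLHS]ger0_norm ?sumr_ge0// -sqrtr_sqr.
  by rewrite ler_wsqrtr//; exact: step.
have sk k : (k <= K)%N -> #|P|%:R ^+ k * s 0 <= Num.sqrt D ^+ k * s k.
  elim: k => [|k IH] kK; first by rewrite !expr0.
  rewrite !exprS -mulrA.
  apply: le_trans (ler_wpM2l (ltW P0) (IH (ltnW kK))) _.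
  rewrite mulrCA -mulrA (mulrCA (Num.sqrt D)) ler_wpM2l ?exprn_ge0 ?sqrtr_ge0//.
  exact: sS.
have Pk : 0 < #|P|%:R ^+ K :> R by rewrite exprn_gt0.
have := cauchy_schwarz_sqrt (MF0 K) (MG0 K); rewrite !sum_marginal// -/(s K) => cs.
rewrite -/(s 0) -(@ler_pM2l _ ((#|P|%:R ^+ K) ^+ 2)) ?exprn_gt0// -exprMn; apply: (@le_trans _ _ ((Num.sqrt D ^+ K * s K) ^+ 2)).
  by rewrite ler_sqr ?nnegrE ?mulr_ge0 ?exprn_ge0 ?sqrtr_ge0//; exact: sk.
have -> : (Num.sqrt D ^+ K * s K) ^+ 2 = D ^+ K * s K ^+ 2.
  by rewrite exprMn -exprM mulnC exprM sqr_sqrtr.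
apply: le_trans (ler_wpM2l (exprn_ge0 K D0) cs) _.
by rewrite le_eqVlt; apply/orP; left; apply/eqP; ring.
Qed.

End Windows.

(** * Extension of finitely additive contents *)

Section LocalSets.
Variables (d : nat) (A : finType) (a0 : A).
Implicit Types x y : X d a0.

Definition local_set (D : set (X d a0)) : Prop :=
  exists n, forall x y, agree n x y -> D x -> D y.

Lemma local_set0 : local_set set0. Proof. by exists 0. Qed.

Lemma local_setU : setU_closed local_set.
Proof.
move=> D E [m hD] [n hE]; exists (maxn m n) => x y h [Dx|Ex]; [left|right].
- by apply: hD Dx; apply: agree_le h; rewrite leq_maxl.
- by apply: hE Ex; apply: agree_le h; rewrite leq_maxr.
Qed.

Lemma local_setC : setC_closed local_set.
Proof. by move=> D [n hD]; exists n => x y h nDx Dy; apply/nDx/(hD y) => //; exact: agree_sym. Qed.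

Lemma local_setI : setI_closed local_set.
Proof.
by move=> D E lD lE; rewrite -[D `&` E]setCK setCI; apply/local_setC/local_setU; exact: local_setC.
Qed.

Lemma local_setT : local_set setT. Proof. by exists 0. Qed.

Lemma local_set_cylinder n (w : pattern d A n) : local_set (cylinder w).
Proof. by exists n => x y; rewrite cylinderE/= => /restr_eqP ->. Qed.

Lemma local_set_shift (u : site d) (D : set (X d a0)) :
  local_set D -> local_set (shift u @^-1` D).
Proof.
move=> [n hD]; exists (n + norm_site u)%N => x y h; apply: hD.
exact: agree_shift h.
Qed.

(** Compactness of X: since A is finite, an ultrafilter selects a value at each site, and a box
    involves only finitely many sites. *)
Lemma agree_ultrafilter (U : set_system (X d a0)) : UltraFilter U ->
  exists x, forall n, U [set y | agree n x y].
Proof.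
move=> UU.
have /choice[x Ux] : forall v : site d, exists a, U [set y : X d a0 | y v = a].
  move=> v; apply: contrapT => /forallNP na.
  have : U [set y : X d a0 | forall a, y v <> a].
    apply: filter_forall => a; have [/na//|] := in_ultra_setVsetC [set y : X d a0 | y v = a] UU.
    by [].
  by move=> /filter_ex[y /(_ (y v))].
exists x => n.
have : U [set y : X d a0 | forall p : box d n, y (box_site p) = x (box_site p)].
  by apply: filter_forall => p; exact: Ux.
by apply: filterS => y h v vn; rewrite -(unboxK vn) h.
Qed.

(** If infinitely many pieces were nonempty, the remainders [B n] would generate a proper filter,
    and an ultrafilter refining it would converge to some x. *)
Lemma local_set_compact (F : (set (X d a0))^nat) :
  (forall i, local_set (F i)) -> trivIset setT F -> local_set (\bigcup_i F i) ->
  exists n, forall i, (n <= i)%N -> F i = set0.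
Proof.
move=> lF tF [n0 lU]; apply: contrapT => /forallNP nF.
pose B n := \bigcup_i F i `\` \bigcup_(i < n) F i.
have B0 n : B n !=set0.
  have /existsNP[i /not_implyP[ni /eqP/set0P[x Fix]]] := nF n.
  exists x; split; first by exists i.
  move=> [j /= jn Fjx]; have : i = j by apply: tF => //; exists x.
  by move=> ij; move: jn; rewrite -ij ltnNge ni.
pose FF : set_system (X d a0) := [set S | exists n, B n `<=` S].
have FFP : ProperFilter FF.
  split; first by move=> [n nB]; have [x Bx] := B0 n; exact: nB Bx.
  split.
  - by exists 0.
  - move=> S T [m mS] [n nT]; exists (maxn m n) => x [Ux nx]; split.
      by apply: mS; split => // -[i /= im Fi]; apply: nx; exists i => //=; rewrite leq_max im.
    by apply: nT; split => // -[i /= im Fi]; apply: nx; exists i => //=; rewrite leq_max im orbT.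
  - by move=> S T ST [n nS]; exists n; exact: subset_trans ST.
have [U [UU FU]] := ultraFilterLemma FFP.
have [x Ux] := agree_ultrafilter UU.
have UB n : U (B n) by apply: FU; exists n.
(* The union is local, so it contains the limit point x. The piece [F i] holding x is local too,
   hence meets [B i.+1], which excludes it. *)
have [i _ Fix] : (\bigcup_i F i) x.
  have /(@filter_ex _ U)[y [yx [Uy _]]] : U ([set y | agree n0 x y] `&` B 0) by exact: filterI.
  by apply: lU Uy; exact: agree_sym.
have [m lFi] := lF i.
have /(@filter_ex _ U)[y [yx [_]]] : U ([set y | agree m x y] `&` B i.+1) by exact: filterI.
by apply; exists i => //=; exact: lFi yx Fix.
Qed.

(* A copy of the configuration space carrying the algebra of local sets instead of the Borel
   sigma-algebra, as the Caratheodory extension requires. *)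
Definition local_cfg : Type := cfg d a0.
HB.instance Definition _ := Pointed.copy local_cfg (cfg d a0).
HB.instance Definition _ := @isAlgebraOfSets.Build default_measure_display local_cfg
  local_set local_set0 local_setU local_setC.

Lemma local_set_measurable (D : set (X d a0)) : local_set D -> measurable D.
Proof.
move=> [n hD].
have -> : D = \bigcup_(w in [set w : pattern d A n | D (ext a0 w)]) cylinder w.
  apply/seteqP; split => x.
    move=> Dx; exists (restr n x) => /=; last by rewrite cylinderE.
    by apply: hD Dx; apply: agree_sym; exact: agree_ext_restr.
  move=> [w /= Dw]; rewrite cylinderE/= => xw; apply: hD Dw.
  by rewrite -xw; exact: agree_ext_restr.
apply: fin_bigcup_measurable; first exact: finite_finset.
by move=> w _; apply: sub_sigma_algebra; exists n, w.
Qed.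

Lemma measurable_shift (u : site d) : measurable_fun setT (@shift d A a0 u).
Proof.
apply: (@measurability _ _ (X d a0) (X d a0) setT (shift u) (@cylinders d A a0)) => //.
move=> _ [_ [n [w ->]] <-]; rewrite setTI; apply: local_set_measurable.
exact/local_set_shift/local_set_cylinder.
Qed.

Lemma measure_eq_local (R : realType) (m1 m2 : {measure set (X d a0) -> \bar R}) :
  (m1 setT < +oo)%E -> (forall D, local_set D -> m1 D = m2 D) ->
  forall D, measurable D -> m1 D = m2 D.
Proof.
move=> fin h D mD.
apply: (@g_sigma_algebra_measure_unique _ R (X d a0) local_set _ (fun=> setT) _ _ m1 m2) => //.
- exact: local_set_measurable.
- by move=> _; exact: local_setT.
- by rewrite bigcup_const.
- exact: local_setI.
- apply: sub_sigma_algebra2 mD => _ [n [w ->]]; exact: local_set_cylinder.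
Qed.

Section Extension.
Variables (R : realType) (rho : set (X d a0) -> R).
Hypothesis rho_ge0 : forall D, 0 <= rho D.
Hypothesis rhoT : rho setT = 1.
Hypothesis rhoU : forall D E, D `&` E = set0 -> rho (D `|` E) = rho D + rho E.

Let rho0 : rho set0 = 0.
Proof. by have := rhoU (setI0 set0); rewrite setU0; lra. Qed.

Definition premeasure (D : set local_cfg) : \bar R := (rho D)%:E.

Let premeasure0 : premeasure set0 = 0%E.
Proof. by rewrite /premeasure rho0. Qed.

Let premeasure_ge0 D : (0 <= premeasure D)%E.
Proof. by rewrite lee_fin. Qed.

(** By compactness only finitely many sets of the sequence are nonempty, so finite additivity is
    enough. *)
Let premeasure_semi_sigma_additive : semi_sigma_additive premeasure.
Proof.
move=> F mF tF mUF.
have add n : (\sum_(0 <= i < n) premeasure (F i) = premeasure (\bigcup_(i < n) F i))%E.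
  elim: n => [|n IH].
    by rewrite big_geq// bigcup_mkord big_ord0 premeasure0.
  rewrite big_nat_recr//= IH /premeasure -EFinD; congr (_%:E).
  rewrite !bigcup_mkord big_ord_recr/= rhoU// -bigcup_mkord.
  apply/eqP/negPn/negP => /set0P[x [[i /= ni Fi] Fn]].
  have ein : i = n by apply: tF => //; exists x.
  by rewrite ein ltnn in ni.
have [n hn] := local_set_compact mF tF mUF.
apply: cvg_near_cst; near=> k; rewrite add; congr premeasure.
apply/seteqP; split => x; first by move=> [i _ Fi]; exists i.
move=> [i _ Fi]; exists i => //=; rewrite ltnNge; apply/negP => ki.
suff : F i = set0 by move=> Fi0; rewrite Fi0 in Fi.
by apply: hn; apply: leq_trans ki; near: k; exact: nbhs_infty_ge.
Unshelve. all: by end_near. Qed.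

HB.instance Definition _ := isMeasure.Build _ _ _ premeasure
  premeasure0 premeasure_ge0 premeasure_semi_sigma_additive.

Definition extension (D : set (X d a0)) : \bar R := measure_extension premeasure D.

Let sub_measurable (D : set (X d a0)) : measurable D ->
  measurable (D : set (g_sigma_algebraType (@measurable _ local_cfg))).
Proof. apply: sub_sigma_algebra2 => _ [n [w ->]]; exact: local_set_cylinder. Qed.

Lemma extension_local (D : set (X d a0)) : local_set D -> extension D = (rho D)%:E.
Proof. by move=> lD; rewrite /extension /measure_extension measurable_mu_extE. Qed.

Let extension0 : extension set0 = 0%E.
Proof. exact: measure0. Qed.

Let extension_ge0 D : (0 <= extension D)%E.
Proof. exact: measure_ge0. Qed.

Let extension_semi_sigma_additive : semi_sigma_additive extension.
Proof.
move=> F mF tF mUF; apply: (@measure_semi_sigma_additive _ _ R (measure_extension premeasure)) => //.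
- by move=> i; exact: sub_measurable.
- exact: sub_measurable.
Qed.

HB.instance Definition _ := isMeasure.Build _ _ _ extension
  extension0 extension_ge0 extension_semi_sigma_additive.

Let extensionT : extension setT = 1%E.
Proof. by rewrite extension_local ?rhoT//; exact: local_setT. Qed.

HB.instance Definition _ := Measure_isProbability.Build _ _ _ extension extensionT.

Definition extension_probability : probability (X d a0) R := extension.

End Extension.
End LocalSets.

(** * Integrals and entropy of invariant measures *)

Lemma cvg_inv_odd (R : realType) : ((N.*2.+1)%:R : R)^-1 @[N --> \oo] --> (0 : R).
Proof.
apply: (@squeeze_cvgr _ _ _ _ (fun=> 0) (@harmonic R)).
- near=> N; rewrite invr_ge0 ler0n /harmonic /= lef_pV2 ?posrE ?ltr0n// ler_nat ltnS.
  by rewrite -addnn leq_addr.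
- exact: cvg_cst.
- exact: cvg_harmonic.
Unshelve. all: by end_near. Qed.

(* A Fekete lemma: the limit is the infimum of u. *)
Lemma cvg_subadditive (R : realType) (u : R^nat) (r : nat -> R^nat) :
  (forall n, 0 <= u n) -> (forall n, r n N @[N --> \oo] --> (1 : R)) ->
  (forall n N, u N <= r n N * u n) -> cvgn u /\ forall n, limn u <= u n.
Proof.
move=> u0 r1 ur.
pose i := inf (range u).
have hi : has_inf (range u) by split; [exists (u 0%N), 0%N | exists 0 => _ [n _ <-]].
have iu n : i <= u n by apply: ge_inf; [exact: hi.2|exists n].
have ui : u @ \oo --> i.
  apply/cvgrPdist_lt => e e0.
  have [_ [n _ <-] un] := inf_adherent (divr_gt0 e0 (ltr0n R 2)) hi.
  have run : r n N * u n @[N --> \oo] --> u n.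
    by rewrite -[X in _ --> X]mul1r; apply: cvgM; [exact: r1|exact: cvg_cst].
  have e2 : 0 < e / 2 by rewrite divr_gt0.
  have /cvgrPdist_lt/(_ _ e2) := run; apply: filterS => N.
  rewrite ltr_distlC => /andP[_ h]; rewrite distrC ger0_norm ?subr_ge0//.
  have := ur n N; move: un; rewrite -/i; lra.
by split; [apply/cvg_ex; exists i|move=> n; rewrite (cvg_lim _ ui)].
Qed.

Section Measures.
Variables (d : nat) (A : finType) (a0 : A) (R : realType).
Implicit Types (x y : X d a0) (nu : probability (X d a0) R).

Definition vol (N : nat) : R := (N.*2.+1)%:R ^+ d.

Lemma vol_gt0 N : 0 < vol N. Proof. by rewrite exprn_gt0// ltr0n. Qed.

Lemma card_box_vol N : #|{: box d N}|%:R = vol N.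
Proof. by rewrite card_box natrX. Qed.

Lemma cvg_vol_ratio n : vol (N + n) / vol N @[N --> \oo] --> (1 : R).
Proof.
have h1 : 1 + (n.*2)%:R * ((N.*2.+1)%:R : R)^-1 @[N --> \oo] --> (1 : R).
  rewrite -[X in _ --> X]addr0 -[X in _ + X](mulr0 (n.*2)%:R).
  by apply: cvgD; [exact: cvg_cst|apply: cvgM; [exact: cvg_cst|exact: cvg_inv_odd]].
have h : (1 + (n.*2)%:R * ((N.*2.+1)%:R : R)^-1) ^+ d @[N --> \oo] --> (1 : R).
  rewrite -[X in _ --> X](expr1n _ d).
  apply: (@cvg_comp _ _ _ (fun N : nat => 1 + (n.*2)%:R * ((N.*2.+1)%:R : R)^-1) (fun z : R => z ^+ d)).
    exact: h1.
  exact: exprn_continuous.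
apply: cvg_trans h; apply: near_eq_cvg; near=> N.
rewrite /vol -expr_div_n; congr (_ ^+ _).
rewrite (_ : (N + n).*2.+1 = (N.*2.+1 + n.*2)%N); last by rewrite doubleD addSn.
by rewrite natrD mulrDl divff// pnatr_eq0.
Unshelve. all: by end_near. Qed.

Definition law nu n (w : pattern d A n) : R := fine (nu (cylinder w)).

Lemma law_ge0 nu n (w : pattern d A n) : 0 <= law nu w.
Proof. exact: fine_ge0. Qed.

Lemma measurable_cylinder n (w : pattern d A n) : measurable (cylinder w : set (X d a0)).
Proof. by apply: local_set_measurable; exact: local_set_cylinder. Qed.

Lemma measurable_local_fun (f : X d a0 -> R) n :
  (forall x y, agree n x y -> f x = f y) -> measurable_fun setT f.
Proof.
move=> hf _ B mB; rewrite setTI; apply: local_set_measurable.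
by exists n => x y /hf; rewrite /preimage/= => ->.
Qed.

Definition bounded_meas (f : X d a0 -> R) : Prop :=
  measurable_fun setT f /\ exists M, forall x, `|f x| <= M.

Definition mean nu (f : X d a0 -> R) : R := fine (\int[nu]_x (f x)%:E).

Lemma bounded_meas_integrable nu (f : X d a0 -> R) :
  bounded_meas f -> nu.-integrable setT (EFin \o f).
Proof.
move=> [mf [M fM]]; apply: measurable_bounded_integrable => //.
  exact: fin_num_fun_lty.
exists M; split; first exact: num_real.
by move=> N MN x _ /=; apply: le_trans (fM x) (ltW MN).
Qed.

Lemma meanE nu (f : X d a0 -> R) : bounded_meas f ->
  (\int[nu]_x (f x)%:E = (mean nu f)%:E)%E.
Proof.
move=> bf; rewrite fineK//; apply: integrable_fin_num => //.
exact: bounded_meas_integrable.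
Qed.

Lemma integral_local nu n (h : pattern d A n -> R) :
  (\int[nu]_x (h (restr n x))%:E = (\sum_w h w * law nu w)%:E)%E.
Proof.
transitivity (\int[nu]_x (\sum_w (h w)%:E * (\1_(cylinder w) x)%:E))%E.
  apply: eq_integral => x _.
  rewrite (bigD1 (restr n x))//= big1 ?adde0.
    by rewrite indicE mem_set ?mule1//; rewrite cylinderE.
  move=> w wx; rewrite indicE memNset ?mule0// cylinderE/=.
  by apply/eqP; rewrite eq_sym.
have mw (w : pattern d A n) := @measurable_cylinder n w.
have bi (w : pattern d A n) : bounded_meas (\1_(cylinder w)).
  split; first exact: measurable_indic.
  by exists 1 => x; rewrite indicE; case: (_ \in _); rewrite ?normr1 ?normr0.
rewrite integral_sum//=.
  rewrite -sumEFin; apply: eq_bigr => w _.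
  rewrite integralZl//=; last exact: bounded_meas_integrable.
  rewrite integral_indic// setIT EFinM; congr (_ * _)%E.
  by rewrite /law fineK// fin_num_measure.
by move=> w; apply: integrableZl => //; exact: bounded_meas_integrable.
Qed.

Lemma mean_local nu n (h : pattern d A n -> R) :
  mean nu (fun x => h (restr n x)) = \sum_w h w * law nu w.
Proof. by rewrite /mean integral_local. Qed.

Lemma bounded_meas_local n (h : pattern d A n -> R) :
  bounded_meas (fun x : X d a0 => h (restr n x)).
Proof.
split; first by apply: (@measurable_local_fun _ n) => x y /restr_eqP ->.
by exists (\sum_w `|h w|) => x; rewrite (bigD1 (restr n x))//= lerDl sumr_ge0.
Qed.

Lemma bounded_meas_sum (T : finType) (f : T -> X d a0 -> R) :
  (forall t, bounded_meas (f t)) -> bounded_meas (fun x => \sum_t f t x).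
Proof.
move=> bf; split; first by apply: measurable_sum => t; exact: (bf t).1.
have /choice[M fM] t := (bf t).2.
exists (\sum_t M t) => x; apply: le_trans (ler_norm_sum _ _ _) _.
by apply: ler_sum.
Qed.

Lemma mean_sum nu (T : finType) (f : T -> X d a0 -> R) :
  (forall t, bounded_meas (f t)) -> mean nu (fun x => \sum_t f t x) = \sum_t mean nu (f t).
Proof.
move=> bf; apply: EFin_inj; rewrite -meanE; last exact: bounded_meas_sum.
under eq_integral do rewrite -sumEFin.
rewrite integral_sum//; last by move=> t; exact: bounded_meas_integrable.
by rewrite -sumEFin; apply: eq_bigr => t _; rewrite meanE.
Qed.

Lemma mean_le nu (f g : X d a0 -> R) (e : R) : bounded_meas f -> bounded_meas g ->
  (forall x, f x <= g x + e) -> mean nu f <= mean nu g + e.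
Proof.
move=> bf bg fg.
have ie : nu.-integrable setT (EFin \o cst e : X d a0 -> \bar R).
  by apply: bounded_meas_integrable; split; [exact: measurable_cst|exists `|e|].
apply: (@le_trans _ _ (\int[nu]_x (g x + e))).
  apply: le_Rintegral => //; first exact: bounded_meas_integrable.
  apply: bounded_meas_integrable; split.
    by apply: measurable_funD; [exact: bg.1|exact: measurable_cst].
  have [M gM] := bg.2; exists (M + `|e|) => x.
  by apply: le_trans (ler_normD _ _) _; rewrite lerD2r.
rewrite RintegralD//; last exact: bounded_meas_integrable.
by rewrite Rintegral_cst// (congr1 fine (@probability_setT _ _ _ nu)) mulr1.
Qed.

Lemma mean_near nu (f g : X d a0 -> R) (e : R) : bounded_meas f -> bounded_meas g ->
  (forall x, `|f x - g x| <= e) -> `|mean nu f - mean nu g| <= e.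
Proof.
move=> bf bg fg; rewrite ler_distlC.
have h x := fg x; apply/andP; split.
  rewrite lerBlDr; apply: mean_le => // x.
  by have := h x; rewrite ler_distlC => /andP[]; lra.
by apply: mean_le => // x; have := h x; rewrite ler_distlC => /andP[]; lra.
Qed.

Lemma law_sum nu n (D : set (X d a0)) : (forall x y, agree n x y -> D x -> D y) ->
  fine (nu D) = \sum_(w : pattern d A n | `[< D (ext a0 w) >]) law nu w.
Proof.
move=> hD.
have lD : local_set D by exists n.
have -> : nu D = (\int[nu]_x (\1_D x)%:E)%E.
  by rewrite integral_indic ?setIT//; exact: local_set_measurable.
rewrite (eq_integral (fun x => ((fun w => (`[< D (ext a0 w) >])%:R : R) (restr n x))%:E)).
  rewrite (integral_local nu (fun w : pattern d A n => (`[< D (ext a0 w) >])%:R : R))/= [RHS]big_mkcond; apply: eq_bigr => w _.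
  by case: ifP => _; rewrite ?mul1r ?mul0r.
move=> x _; rewrite indicE; congr ((nat_of_bool _)%:R%:E).
apply/idP/asboolP; rewrite inE; apply: hD; last exact: agree_ext_restr.
by apply: agree_sym; exact: agree_ext_restr.
Qed.

Lemma law_sum1 nu n : \sum_(w : pattern d A n) law nu w = 1.
Proof.
have := @law_sum nu n setT (fun _ _ _ _ => I); rewrite probability_setT/= => ->.
by apply: eq_bigl => w; apply/esym/asboolP.
Qed.

Lemma mean_shift nu (u : site d) (f : X d a0 -> R) : shift_invariant nu -> bounded_meas f ->
  bounded_meas (f \o shift u) /\ mean nu (f \o shift u) = mean nu f.
Proof.
move=> inv bf.
have mS := @measurable_shift d A a0 u.
have bfS : bounded_meas (f \o shift u).
  split; first exact: measurableT_comp bf.1 mS.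
  by have [M fM] := bf.2; exists M => x; exact: fM.
split=> //; rewrite /mean; congr fine.
transitivity (\int[pushforward nu (shift u : X d a0 -> X d a0)]_x (f x)%:E)%E.
  rewrite integral_pushforward//=.
  - by apply/measurable_EFinP; exact: bf.1.
  - exact: bounded_meas_integrable.
by apply: eq_measure_integral => D mD _; exact: inv.
Qed.

Definition block_entropy nu n : R :=
  \sum_(w : pattern d A n) (- (law nu w * ln (law nu w))).

(** Every site of the box of radius N lies in (2n+1)^d of the windows of radius n centred in the box
    of radius N + n. The law G is arbitrary because the bound serves both the marginals of invariant
    measures and the finite-volume Gibbs laws. *)
Lemma block_shearer (W : finType) (G : W -> R) (xi : W -> X d a0) (n N : nat) :
  (forall w, 0 <= G w) -> \sum_w G w = 1 ->
  (n.*2.+1)%:R ^+ d *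
    (\sum_(t : pattern d A N) - ((\sum_(w | restr N (xi w) == t) G w) * ln (\sum_(w | restr N (xi w) == t) G w)))
  <= \sum_(c : box d (N + n)) \sum_(t : pattern d A n)
     - ((\sum_(w | restr n (shift (box_site c) (xi w)) == t) G w) *
       ln (\sum_(w | restr n (shift (box_site c) (xi w)) == t) G w)).
Proof.
move=> G0 G1.
pose F (c : box d (N + n)) := [set v : site d | (norm_site (sub_site v (box_site c)) <= n)%N].
have := @shearer R W G G0 (site d) A xi (box d N) (box d (N + n)) (@box_site d N) F #|{: box d n}| G1.
have -> : \sum_c set_entropy G xi (F c) = \sum_(c : box d (N + n)) \sum_(t : pattern d A n)
     - ((\sum_(w | restr n (shift (box_site c) (xi w)) == t) G w) *
       ln (\sum_(w | restr n (shift (box_site c) (xi w)) == t) G w)).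
  apply: eq_bigr => c _; rewrite -class_entropyE; congr class_entropy.
  apply/funext => w; apply/funext => w'; apply/asboolP/eqP => /=.
    move=> h; apply/restr_eqP => v vn; apply: h.
    by rewrite /F/= -/(add_site v (box_site c)) add_siteK.
  by move=> /restr_eqP h v /h; rewrite /shift -/(add_site (sub_site v (box_site c)) (box_site c)) sub_siteK.
have -> : set_entropy G xi (range (@box_site d N)) = \sum_(t : pattern d A N) -
   ((\sum_(w | restr N (xi w) == t) G w) * ln (\sum_(w | restr N (xi w) == t) G w)).
  rewrite -class_entropyE; congr class_entropy.
  apply/funext => w; apply/funext => w'; apply/asboolP/eqP => /=.
    by move=> h; apply/ffunP => p; rewrite !ffunE; apply: h; exists p.
  by move=> h _ [p _ <-]; have := congr1 (fun w : pattern d A N => w p) h; rewrite !ffunE.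
move=> sh; rewrite -/(vol n) -card_box_vol mulr_natl; apply: sh => t.
(* The windows containing the site of t are centred at its differences with the sites q of the small
   box. *)
pose f (q : box d n) := unbox (N + n) (sub_site (box_site t) (box_site q)).
have fE q : box_site (f q) = sub_site (box_site t) (box_site q).
  rewrite unboxK//; apply: leq_trans (norm_sub_site _ _) _.
  by apply: leq_add; exact: norm_box_site.
have finj : injective f.
  move=> q q' /(congr1 (@box_site d (N + n))); rewrite !fE => h.
  apply: (@box_site_inj d n); apply/funext => i.
  by have := congr1 (fun v : site d => v i) h; rewrite /sub_site; lia.
rewrite -(card_codom finj); apply: subset_leq_card; apply/fintype.subsetP => c /codomP[q ->].
have Fq : F (f q) (box_site t).
  rewrite /F/= fE.
  have -> : sub_site (box_site t) (sub_site (box_site t) (box_site q)) = box_site q.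
    by apply/funext => i; rewrite /sub_site; ring.
  exact: norm_box_site.
by change (is_true `[< F (f q) (box_site t) >]); exact/asboolP.
Qed.

Lemma law_shift nu n M (u : site d) (t : pattern d A n) : shift_invariant nu ->
  (n + norm_site u <= M)%N ->
  \sum_(w : pattern d A M | restr n (shift u (ext a0 w)) == t) law nu w = law nu t.
Proof.
move=> inv nM.
rewrite /law -(inv u); last exact: measurable_cylinder.
rewrite (@law_sum nu M).
  by apply: eq_bigl => w; rewrite cylinderE/=; apply/eqP/asboolP.
move=> x y /(agree_shift nM) h; rewrite cylinderE/= => <-.
by apply/esym/restr_eqP.
Qed.

Lemma block_entropy_subadd nu n N : shift_invariant nu ->
  (n.*2.+1)%:R ^+ d * block_entropy nu N <= vol (N + n) * block_entropy nu n.
Proof.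
move=> inv.
(* The radius N + n + n contains every window of radius n centred in the box of radius N + n. *)
have := @block_shearer (pattern d A (N + n + n)) (@law nu (N + n + n)) (@ext d A a0 (N + n + n)) n N
  (@law_ge0 nu _) (law_sum1 nu _).
have -> : \sum_(c : box d (N + n)) \sum_(t : pattern d A n)
     - ((\sum_(w : pattern d A (N + n + n) | restr n (shift (box_site c) (ext a0 w)) == t) law nu w) *
       ln (\sum_(w : pattern d A (N + n + n) | restr n (shift (box_site c) (ext a0 w)) == t) law nu w)) =
   vol (N + n) * block_entropy nu n.
  rewrite -card_box_vol -sumr_constT; apply: eq_bigr => c _; apply: eq_bigr => t _.
  rewrite law_shift//; by have := norm_box_site c; lia.
congr (_ * _ <= _); apply: eq_bigr => t _.
suff -> : \sum_(w : pattern d A (N + n + n) | restr N (ext a0 w) == t) law nu w = law nu t by [].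
rewrite /law (@law_sum nu (N + n + n)).
  by apply: eq_bigl => w; rewrite cylinderE/=; apply/eqP/asboolP.
move=> x y h; rewrite cylinderE/= => <-; apply/esym/restr_eqP.
by apply: agree_le h; lia.
Qed.

Lemma block_entropy_ge0 nu n : 0 <= block_entropy nu n.
Proof.
apply: sumr_ge0 => w _; rewrite oppr_ge0 mulr_ge0_le0 ?law_ge0//.
apply: ln_le0; rewrite -(law_sum1 nu n) (bigD1 w)//= lerDl.
by apply: sumr_ge0 => w' _; exact: law_ge0.
Qed.

(** Shearer's bound divided by volumes is the hypothesis of the Fekete lemma. The convergence gives
    [limn] in [entropy] its meaning, and the upper bounds feed the variational inequality. *)
Lemma entropy_lim nu : shift_invariant nu ->
  (block_entropy nu n / vol n @[n --> \oo] --> entropy nu) /\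
  forall n, entropy nu <= block_entropy nu n / vol n.
Proof.
move=> inv.
have -> : entropy nu = limn (fun n => block_entropy nu n / vol n).
  by rewrite /entropy; congr (lim (_ @ \oo)); apply/funext => n; rewrite mulrC.
have [] := @cvg_subadditive R (fun n => block_entropy nu n / vol n) (fun n N => vol (N + n) / vol N).
- by move=> n; rewrite divr_ge0 ?block_entropy_ge0// ltW// vol_gt0.
- exact: cvg_vol_ratio.
- move=> n N; have := block_entropy_subadd n N inv; rewrite -/(vol n) => h.
  have -> : vol (N + n) / vol N * (block_entropy nu n / vol n) =
      (vol (N + n) * block_entropy nu n) / vol n / vol N.
    by field; rewrite !gt_eqF ?vol_gt0.
  by rewrite ler_pM2r ?invr_gt0 ?vol_gt0// ler_pdivlMr ?vol_gt0// mulrC.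
by [].
Qed.

End Measures.

(** * Pressure and equilibrium states *)

(** A compact interval provides a cluster point, to which an ultrafilter must converge. *)
Lemma cvg_ultra_bounded (R : realType) (T : Type) (U : set_system T) (u : T -> R) (M : R) :
  UltraFilter U -> (forall t, `|u t| <= M) -> u @ U --> lim (u @ U).
Proof.
move=> UU uM.
have [l [_ lU]] : (`[- M, M]%classic : set R) `&` cluster (u @ U) !=set0.
  apply: (@segment_compact R (- M) M (u @ U)).
  by apply: nearW => t /=; rewrite in_itv/= -ler_norml.
suff : u @ U --> l by move=> /cvgP.
move=> V Vl; have [//|nV] := in_ultra_setVsetC (u @^-1` V) UU.
by have [z [nVz Vz]] := lU (~` V) V nV Vl.
Qed.

Lemma cvg_oo_ultra (R : realType) (U : set_system nat) (u : R^nat) (l : R) :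
  \oo `<=` U -> u @ \oo --> l -> u @ U --> l.
Proof. by move=> ooU ul V Vl; apply: ooU; exact: ul. Qed.

Lemma cvg_ge_ultra (R : realType) (T : Type) (U : set_system T) (u : T -> R) (l a : R) :
  ProperFilter U -> u @ U --> l -> (forall t, a <= u t) -> a <= l.
Proof.
move=> PU ul au; rewrite -(cvg_lim _ ul)//.
by apply: limr_ge; [exact: cvgP ul|exact: nearW].
Qed.

Lemma cvg_le_ultra (R : realType) (T : Type) (U : set_system T) (u w : T -> R) (l m : R) :
  ProperFilter U -> u @ U --> l -> w @ U --> m -> (forall t, u t <= w t) -> l <= m.
Proof.
move=> PU ul wm uw; rewrite -subr_ge0.
by apply: (cvg_ge_ultra PU (cvgB wm ul)) => t; rewrite subr_ge0; exact: uw.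
Qed.

Lemma cvg_fin_sum (R : realType) (T : Type) (I : finType) (U : set_system T)
    (u : I -> T -> R) (l : I -> R) : ProperFilter U ->
  (forall i, u i @ U --> l i) -> \sum_i u i t @[t --> U] --> \sum_i l i.
Proof.
move=> PU ul; elim: (index_enum I) => [|i s IH].
  by rewrite big_nil; under eq_fun do rewrite big_nil; exact: cvg_cst.
rewrite big_cons; under eq_fun do rewrite big_cons.
by apply: cvgD => //; exact: ul.
Qed.

Section Xlogx.
Variable R : realType.
Implicit Types x : R.

(** Obtained from [ln t <= t - 1] at the inverse square root of x; it squeezes the entropy function
    to 0 where [ln] itself is discontinuous. *)
Lemma xlogx_bounds x : 0 <= x -> x <= 1 -> 0 <= - (x * ln x) <= 2 * Num.sqrt x.
Proof.
move=> x0 x1; have [->|xn0] := eqVneq x 0; first by rewrite mul0r oppr0 sqrtr0 mulr0 lexx.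
have xp : 0 < x by rewrite lt_neqAle eq_sym xn0.
apply/andP; split; first by rewrite oppr_ge0 mulr_ge0_le0// ln_le0.
have s0 : 0 < Num.sqrt x by rewrite sqrtr_gt0.
have := @ln_le_sub1 R (Num.sqrt x)^-1; rewrite invr_gt0 lnV ?posrE// => /(_ s0).
have -> : ln x = ln (Num.sqrt x) *+ 2 by rewrite -lnXn// sqr_sqrtr.
move=> /(ler_wpM2l x0); rewrite mulrBr mulr1.
have -> : x / Num.sqrt x = Num.sqrt x.
  by rewrite -{1}(sqr_sqrtr x0) expr2 mulfK// gt_eqF.
rewrite mulrN mulrnAr; move: x0; lra.
Qed.

Lemma xlogx_le1 x : 0 <= x -> x <= 1 -> - (x * ln x) <= 1.
Proof.
move=> x0 x1; have [->|xn0] := eqVneq x 0; first by rewrite mul0r oppr0 ler01.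
have xp : 0 < x by rewrite lt_neqAle eq_sym xn0.
have := @ln_le_sub1 R x^-1; rewrite invr_gt0 lnV ?posrE// => /(_ xp) /(ler_wpM2l x0).
by rewrite mulrBr divff//; lra.
Qed.

Lemma xlogx_cvg (U : set_system nat) (u : R^nat) (l : R) : ProperFilter U ->
  (forall n, 0 <= u n <= 1) -> u @ U --> l ->
  - (u n * ln (u n)) @[n --> U] --> - (l * ln l).
Proof.
move=> PU u01 ul.
have l0 : 0 <= l by apply: (cvg_ge_ultra PU ul) => n; have /andP[] := u01 n.
have [l_0|ln0] := eqVneq l 0; last first.
  have lp : 0 < l by rewrite lt_neqAle eq_sym ln0.
  apply: cvgN; apply: cvgM => //.
  by apply: (cvg_comp _ _ ul); exact: continuous_ln.
rewrite l_0 mul0r oppr0; rewrite l_0 in ul.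
apply: (@squeeze_cvgr _ _ _ _ (fun=> 0) (fun n => 2 * Num.sqrt (u n))).
- by apply: nearW => n; have /andP[a b] := u01 n; exact: xlogx_bounds.
- exact: cvg_cst.
- rewrite -[X in _ --> X](mulr0 2); apply: cvgM; first exact: cvg_cst.
  rewrite -(sqrtr0 R); apply: (cvg_comp _ _ ul); exact: sqrt_continuous.
Qed.

End Xlogx.

(** * Boundary terms in sums over boxes *)

Section BoxSums.
Variables (d : nat) (R : realType).

Lemma box_sum_shift (N M : nat) (u : site d) (f : site d -> R) : (N + norm_site u <= M)%N ->
  \sum_(c : box d N) f (add_site (box_site c) u) =
  \sum_(c : box d M | (norm_site (sub_site (box_site c) u) <= N)%N) f (box_site c).
Proof.
move=> NM; symmetry.
have uc (c : box d N) : box_site (unbox M (add_site (box_site c) u)) = add_site (box_site c) u.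
  rewrite unboxK//; apply: leq_trans (norm_add_site _ _) _.
  by have := norm_box_site c; lia.
rewrite (reindex_onto (fun c : box d N => unbox M (add_site (box_site c) u))
   (fun c : box d M => unbox N (sub_site (box_site c) u))); last first.
  move=> c cm; rewrite unboxK//; apply: (@box_site_inj d M).
  by rewrite unboxK sub_siteK// norm_box_site.
apply: eq_big => [c|c _]; last by rewrite uc.
by rewrite uc add_siteK norm_box_site box_siteK eqxx.
Qed.

Lemma box_sum_le (N k : nat) (f : site d -> R) (B : R) : (forall w, f w <= B) ->
  \sum_(c : box d (N + k)) f (box_site c) <=
  \sum_(c : box d N) f (box_site c) + (vol d R (N + k) - vol d R N) * B.
Proof.
move=> fB.
pose o : site d := fun=> 0.
have no : norm_site o = 0%N by apply/eqP; rewrite -leqn0; apply/bigmax_leqP.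
have e (g : site d -> R) : \sum_(c : box d (N + k)) g (box_site c) =
    \sum_(c : box d N) g (box_site c) +
    \sum_(c : box d (N + k) | ~~ (norm_site (sub_site (box_site c) o) <= N)%N) g (box_site c).
  rewrite (bigID (fun c : box d (N + k) => (norm_site (sub_site (box_site c) o) <= N)%N))/=.
  congr (_ + _); rewrite -box_sum_shift; last by rewrite no; lia.
  apply: eq_bigr => c _; congr g; apply/funext => i; exact: addr0.
rewrite e lerD2l.
apply: (@le_trans _ _ (\sum_(c : box d (N + k) | ~~ (norm_site (sub_site (box_site c) o) <= N)%N) B)).
  by apply: ler_sum.
have := e (fun=> B); rewrite !sumr_constT !card_box_vol; lra.
Qed.

(** The translated box stays inside the box of radius N + k, which bounds the increase; applying
    this to [1 - f] bounds the decrease. *)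
Lemma box_sum_translate (N k : nat) (u : site d) (f : site d -> R) : (norm_site u <= k)%N ->
  (forall w, 0 <= f w <= 1) ->
  `|\sum_(c : box d N) f (add_site (box_site c) u) - \sum_(c : box d N) f (box_site c)|
  <= vol d R (N + k) - vol d R N.
Proof.
move=> uk.
have main (g : site d -> R) : (forall w, 0 <= g w <= 1) ->
    \sum_(c : box d N) g (add_site (box_site c) u) <=
    \sum_(c : box d N) g (box_site c) + (vol d R (N + k) - vol d R N).
  move=> g01.
  rewrite (@box_sum_shift N (N + k)); last by rewrite leq_add2l.
  have g1 w : g w <= 1 by have /andP[] := g01 w.
  have := @box_sum_le N k g 1 g1; rewrite mulr1; apply: le_trans.
  rewrite [leRHS](bigID (fun c : box d (N + k) => (norm_site (sub_site (box_site c) u) <= N)%N))/=.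
  by rewrite lerDl; apply: sumr_ge0 => c _; have /andP[] := g01 (box_site c).
move=> f01; have := main f f01.
have := main (fun w => 1 - f w) (fun w => ltac:(have /andP[a b] := f01 w; apply/andP; split; lra)).
rewrite !sumrB => h1 h2; rewrite ler_norml; apply/andP; split; lra.
Qed.

End BoxSums.

Section ShellBoundSmall.
Variables (d : nat) (R : realType) (C : R).

Lemma cvg_shell_bound : (0 < d)%N -> shell_bound d C N / vol d R N @[N --> \oo] --> (0 : R).
Proof.
move=> d0.
have h : ((2 * d * 3 ^ d.-1)%:R * C) * ((N.*2.+1)%:R : R)^-1 @[N --> \oo] --> (0 : R).
  rewrite -[X in _ --> X](mulr0 ((2 * d * 3 ^ d.-1)%:R * C)).
  by apply: cvgM; [exact: cvg_cst|exact: cvg_inv_odd].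
apply: cvg_trans h; apply: near_eq_cvg; near=> N.
have -> : vol d R N = (N.*2.+1)%:R * (N.*2.+1)%:R ^+ d.-1 by rewrite -exprS prednK.
have -> : shell_bound d C N = (2 * d * 3 ^ d.-1)%:R * (N.*2.+1)%:R ^+ d.-1 * C.
  by rewrite /shell_bound -natrX -natrM.
have : (N.*2.+1)%:R != 0 :> R by rewrite pnatr_eq0.
have : (N.*2.+1)%:R ^+ d.-1 != 0 :> R by rewrite expf_neq0// pnatr_eq0.
move: ((N.*2.+1)%:R ^+ d.-1 : R) ((N.*2.+1)%:R : R) ((2 * d * 3 ^ d.-1)%:R : R) => a b e a0 b0.
by field; rewrite a0 b0.
Unshelve. all: by end_near. Qed.

End ShellBoundSmall.

(** * Finite-volume pressure and its variational upper bound *)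

Section LimitState.
Variables (d : nat) (A : finType) (a0 : A) (R : realType) (phi : X d a0 -> R).
Variables (v : nat -> R) (C M : R).
Hypothesis d_gt0 : (0 < d)%N.
Hypothesis v_ge0 : forall k, 0 <= v k.
Hypothesis v_sum : forall n, \sum_(k < n) (k.+1 ^ d.-1)%:R * v k <= C.
Hypothesis v_var : forall k (x y : X d a0), agree k x y -> `|phi x - phi y| <= v k.
Hypothesis phi_bound : forall x, `|phi x| <= M.
Implicit Types (x y : X d a0) (nu : probability (X d a0) R).

Lemma cvg_v : v @ \oo --> (0 : R).
Proof.
apply: cvg_series_cvg_0; apply: nondecreasing_is_cvgn.
  by apply/nondecreasing_series => n _ _; exact: v_ge0.
exists C => _ [n _ <-]; apply: le_trans (v_sum n).
rewrite seriesEord /=; apply: ler_sum => k _.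
by rewrite ler_peMl// -[leLHS]/(1%:R) ler_nat expn_gt0.
Qed.

(** Since [v] tends to 0, phi is a uniform limit of local functions. *)
Lemma bounded_meas_phi : bounded_meas phi.
Proof.
split; last by exists M.
apply: (@measurable_fun_cvg _ (X d a0) R setT (fun n x => phi (ext a0 (restr n x)))).
  by move=> n; exact: (bounded_meas_local a0 (fun w => phi (ext a0 w))).1.
move=> x _; apply/cvgrPdist_le => e e0.
have /cvgrPdist_lt/(_ e e0) := cvg_v; apply: filterS => n.
rewrite sub0r normrN (ger0_norm (v_ge0 n)) => vn; rewrite distrC.
by apply: le_trans (v_var _) (ltW vn); exact: agree_ext_restr.
Qed.

Local Notation S := (birkhoff phi).

Definition partition_function (beta : R) (N : nat) : R :=
  \sum_(w : pattern d A N) expR (beta * S N (ext a0 w)).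

Definition pressure (beta : R) (N : nat) : R := ln (partition_function beta N) / vol d R N.

Lemma partition_function_gt0 beta N : 0 < partition_function beta N.
Proof.
rewrite /partition_function (bigD1 [ffun=> a0])//= ltr_pwDl ?expR_gt0//.
by apply: sumr_ge0 => w _; exact: expR_ge0.
Qed.

Lemma birkhoff_bound N x : `|S N x| <= vol d R N * M.
Proof.
apply: le_trans (ler_norm_sum _ _ _) _; rewrite -card_box_vol -sumr_constT.
by apply: ler_sum.
Qed.

Lemma card_pattern N : #|{: pattern d A N}|%:R = expR (vol d R N * ln #|A|%:R) :> R.
Proof.
have A0 : 0 < #|A|%:R :> R by rewrite ltr0n; apply/card_gt0P; exists a0.
have -> : vol d R N = (N.*2.+1 ^ d)%:R by rewrite natrX.
by rewrite card_ffun card_box natrX expRM_natl lnK.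
Qed.

Lemma pressure_bound beta N : `|pressure beta N| <= `|beta| * M + `|ln #|A|%:R|.
Proof.
have V0 := vol_gt0 d R N; have Z0 := partition_function_gt0 beta N.
have bS x : - (vol d R N * (`|beta| * M)) <= beta * S N x <= vol d R N * (`|beta| * M).
  by rewrite -ler_norml normrM mulrCA ler_wpM2l//; exact: birkhoff_bound.
rewrite /pressure normrM normfV (gtr0_norm V0) ler_pdivrMr// mulrC ler_norml mulrDr.
apply/andP; split.
  apply: (@le_trans _ _ (- (vol d R N * (`|beta| * M)))).
    by rewrite lerN2 lerDl mulr_ge0// ltW.
  rewrite -[leLHS]expRK ler_ln ?posrE ?expR_gt0//.
  rewrite /partition_function (bigD1 [ffun=> a0])//=.
  rewrite -[leLHS]addr0 lerD//; last by apply: sumr_ge0 => w _; exact: expR_ge0.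
  by rewrite ler_expR; have /andP[] := bS (ext a0 ([ffun=> a0] : pattern d A N)).
rewrite -[leRHS]expRK ler_ln ?posrE ?expR_gt0//.
apply: (@le_trans _ _ (\sum_(w : pattern d A N) expR (vol d R N * (`|beta| * M)))).
  by apply: ler_sum => w _; rewrite ler_expR; have /andP[] := bS (ext a0 w).
rewrite sumr_constT card_pattern -expRD ler_expR addrC lerD2l ler_wpM2l ?ler_norm//.
exact: ltW.
Qed.

Lemma mean_birkhoff nu N : shift_invariant nu ->
  `|\sum_(w : pattern d A N) law nu w * S N (ext a0 w) - vol d R N * mean nu phi| <= shell_bound d C N.
Proof.
move=> inv.
have sh c := mean_shift c inv bounded_meas_phi.
have -> : vol d R N * mean nu phi = mean nu (S N).
  rewrite (mean_sum nu (f := fun (c : box d N) x => phi (shift (box_site c) x))).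
    rewrite -card_box_vol -sumr_constT; apply: eq_bigr => c _.
    by rewrite -(sh (box_site c)).2.
  by move=> c; exact: (sh (box_site c)).1.
have -> : \sum_(w : pattern d A N) law nu w * S N (ext a0 w) = mean nu (fun x => S N (ext a0 (restr N x))).
  by rewrite (mean_local nu (fun w => S N (ext a0 w))); apply: eq_bigr => w _; rewrite mulrC.
apply: mean_near.
- exact: (bounded_meas_local a0 (fun w => S N (ext a0 w))).
- by apply: bounded_meas_sum => c; exact: (sh (box_site c)).1.
- by move=> x; apply: (birkhoff_agree d_gt0 v_ge0 v_sum v_var); exact: agree_ext_restr.
Qed.

Lemma pressure_ge beta nu N : shift_invariant nu ->
  entropy nu + beta * mean nu phi <= pressure beta N + `|beta| * (shell_bound d C N / vol d R N).
Proof.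
move=> inv.
have V0 := vol_gt0 d R N; have Z0 := partition_function_gt0 beta N.
have [_ /(_ N) hN] := entropy_lim inv.
have mb := mean_birkhoff N inv.
set E := \sum_w _ in mb.
(* The marginal of nu on the box is tested against the finite-volume Gibbs law. *)
have gb : block_entropy nu N + beta * E <= ln (partition_function beta N).
  have := @gibbs_inequality R (pattern d A N) (@law _ _ _ _ nu N)
    (fun w => expR (beta * S N (ext a0 w)) / partition_function beta N).
  move=> /(_ (law_ge0 nu (n := N))).
  have q0 (w : pattern d A N) : 0 < expR (beta * S N (ext a0 w)) / partition_function beta N.
    by rewrite divr_gt0// expR_gt0.
  move=> /(_ (fun w => ltW (q0 w)) (fun w _ => q0 w)).
  rewrite -mulr_suml -/(partition_function beta N) divff ?gt_eqF// law_sum1 => /(_ (lexx _)).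
  rewrite -/(block_entropy nu N).
  under [in X in _ <= X -> _]eq_bigr => w _ do
    rewrite ln_div ?posrE ?expR_gt0// expRK mulrBr mulrCA.
  by rewrite sumrB -mulr_sumr -/E -mulr_suml law_sum1 mul1r; lra.
rewrite mulrA /pressure -mulrDl ler_pdivlMr// mulrDl.
move: hN; rewrite ler_pdivlMr// => hN.
have h2 : beta * (vol d R N * mean nu phi) <= beta * E + `|beta| * shell_bound d C N.
  rewrite -lerBlDl -mulrBr; apply: le_trans (ler_norm _) _.
  by rewrite normrM ler_wpM2l// distrC.
move: h2 gb hN; rewrite mulrCA; lra.
Qed.

(** * Limit pressure and the limit of averaged Gibbs laws *)

Section Ultrafilter.
Variable U : set_system nat.
Hypothesis UU : UltraFilter U.
Hypothesis ooU : \oo `<=` U.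

Definition limit_pressure (beta : R) : R := lim (pressure beta @ U).

Lemma cvg_pressure beta : pressure beta @ U --> limit_pressure beta.
Proof. by apply: cvg_ultra_bounded => N; exact: pressure_bound. Qed.

Lemma variational_le beta nu : shift_invariant nu ->
  entropy nu + beta * mean nu phi <= limit_pressure beta.
Proof.
move=> inv.
have h : pressure beta N + `|beta| * (shell_bound d C N / vol d R N) @[N --> U] --> limit_pressure beta.
  rewrite -[X in _ --> X]addr0 -[X in _ + X](mulr0 `|beta|).
  apply: cvgD; first exact: cvg_pressure.
  apply: cvgM; first exact: cvg_cst.
  by apply: cvg_oo_ultra => //; exact: cvg_shell_bound.
by apply: (cvg_ge_ultra _ h) => N; exact: pressure_ge.
Qed.

Variable beta : R.

Definition gibbs N (w : pattern d A N) : R :=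
  expR (beta * S N (ext a0 w)) / partition_function beta N.

Lemma gibbs_gt0 N (w : pattern d A N) : 0 < gibbs w.
Proof. by rewrite divr_gt0 ?expR_gt0// partition_function_gt0. Qed.

Lemma gibbs_sum N : \sum_(w : pattern d A N) gibbs w = 1.
Proof. by rewrite -mulr_suml divff// gt_eqF// partition_function_gt0. Qed.

(** The Gibbs law of a box, placed in the background [a0], is not invariant; averaging over the
    translations by that box leaves only a surface-order defect ([gibbs_avg_shift]). *)
Definition gibbs_avg N (f : X d a0 -> R) : R :=
  (\sum_(c : box d N) \sum_(w : pattern d A N) gibbs w * f (shift (box_site c) (ext a0 w))) / vol d R N.

Lemma gibbs_avg_cst N (r : R) : gibbs_avg N (fun=> r) = r.
Proof.
rewrite /gibbs_avg; under eq_bigr do rewrite -mulr_suml gibbs_sum mul1r.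
by rewrite sumr_constT card_box_vol mulrC mulKf// gt_eqF// vol_gt0.
Qed.

Lemma gibbs_avg_le N (f g : X d a0 -> R) : (forall x, f x <= g x) ->
  gibbs_avg N f <= gibbs_avg N g.
Proof.
move=> fg; rewrite ler_pM2r ?invr_gt0 ?vol_gt0//; apply: ler_sum => c _.
by apply: ler_sum => w _; rewrite ler_wpM2l// ltW// gibbs_gt0.
Qed.

Lemma gibbs_avgD N (f g : X d a0 -> R) :
  gibbs_avg N (fun x => f x + g x) = gibbs_avg N f + gibbs_avg N g.
Proof.
rewrite /gibbs_avg -mulrDl -big_split/=; congr (_ / _); apply: eq_bigr => c _.
by rewrite -big_split; apply: eq_bigr => w _; rewrite mulrDr.
Qed.

Lemma gibbs_avg_sum N (T : finType) (h : T -> R) (f : T -> X d a0 -> R) :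
  gibbs_avg N (fun x => \sum_t h t * f t x) = \sum_t h t * gibbs_avg N (f t).
Proof.
transitivity ((\sum_t \sum_(c : box d N) h t *
    \sum_(w : pattern d A N) gibbs w * f t (shift (box_site c) (ext a0 w))) / vol d R N); last first.
  by rewrite mulr_suml; apply: eq_bigr => t _; rewrite -mulr_sumr mulrA.
rewrite exchange_big/=; congr (_ / _); apply: eq_bigr => c _.
under [RHS]eq_bigr do rewrite mulr_sumr.
rewrite exchange_big/=; apply: eq_bigr => w _.
by rewrite mulr_sumr; apply: eq_bigr => t _; rewrite mulrCA.
Qed.

Lemma gibbs_avg_near N (f g : X d a0 -> R) (e : R) : (forall x, `|f x - g x| <= e) ->
  `|gibbs_avg N f - gibbs_avg N g| <= e.
Proof.
move=> fg.
have h1 : gibbs_avg N f <= gibbs_avg N g + e.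
  rewrite -[X in _ + X](gibbs_avg_cst N e) -gibbs_avgD; apply: gibbs_avg_le => x.
  by have := fg x; rewrite ler_distl => /andP[]; lra.
have h2 : gibbs_avg N g <= gibbs_avg N f + e.
  rewrite -[X in _ + X](gibbs_avg_cst N e) -gibbs_avgD; apply: gibbs_avg_le => x.
  by have := fg x; rewrite ler_distl => /andP[]; lra.
by rewrite ler_distl; apply/andP; split; lra.
Qed.

Lemma indic01 (D : set (X d a0)) x : 0 <= (\1_D x : R) <= 1.
Proof. by rewrite indicE; case: (_ \in _); rewrite ?lexx ler01. Qed.

Lemma gibbs_avg_indic N (D : set (X d a0)) : 0 <= gibbs_avg N \1_D <= 1.
Proof.
have i01 := indic01 D.
apply/andP; split.
  by rewrite -[leLHS](gibbs_avg_cst N); apply: gibbs_avg_le => x; have /andP[] := i01 x.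
by rewrite -[leRHS](gibbs_avg_cst N); apply: gibbs_avg_le => x; have /andP[] := i01 x.
Qed.

Lemma gibbs_avg_shift N (u : site d) (D : set (X d a0)) :
  `|gibbs_avg N \1_(shift u @^-1` D) - gibbs_avg N \1_D| <= vol d R (N + norm_site u) / vol d R N - 1.
Proof.
have V0 := vol_gt0 d R N.
rewrite /gibbs_avg -mulrBl normrM normfV (gtr0_norm V0) ler_pdivrMr// mulrBl mul1r.
rewrite divfK ?gt_eqF// exchange_big [X in _ - X]exchange_big/= -sumrB.
apply: le_trans (ler_norm_sum _ _ _) _.
rewrite -[leRHS]mul1r -(gibbs_sum N) mulr_suml; apply: ler_sum => w _.
rewrite -!mulr_sumr -mulrBr normrM (gtr0_norm (gibbs_gt0 w)) ler_wpM2l ?(ltW (gibbs_gt0 w))//.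
have := @box_sum_translate d R N (norm_site u) u (fun s => \1_D (shift s (ext a0 w))) (leqnn _).
move=> /(_ (fun s => indic01 D (shift s (ext a0 w)))); congr (`|_ - _| <= _); apply: eq_bigr => c _.
rewrite !indicE; congr (nat_of_bool _)%:R.
have -> : shift (add_site (box_site c) u) (ext a0 w) = shift u (shift (box_site c) (ext a0 w)).
  rewrite shift_add (_ : add_site u (box_site c) = add_site (box_site c) u)//.
  by apply/funext => i; exact: addrC.
by [].
Qed.

(* Defined on all subsets, so that finite additivity and shift invariance are immediate; only its
   values on local sets matter in the end. *)
Definition limit_content (D : set (X d a0)) : R := lim (gibbs_avg N \1_D @[N --> U]).

Lemma cvg_limit_content D : gibbs_avg N \1_D @[N --> U] --> limit_content D.
Proof.
apply: (@cvg_ultra_bounded _ _ _ _ 1) => N; have /andP[h0 h1] := gibbs_avg_indic N D.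
by rewrite ger0_norm.
Qed.

Lemma limit_content_ge0 D : 0 <= limit_content D.
Proof.
by apply: (cvg_ge_ultra _ (@cvg_limit_content D)) => N; have /andP[] := gibbs_avg_indic N D.
Qed.

Lemma limit_contentT : limit_content setT = 1.
Proof.
rewrite /limit_content (_ : (fun N => _) = fun=> 1); first exact: lim_cst.
by apply/funext => N; rewrite indicT gibbs_avg_cst.
Qed.

Lemma limit_contentU D E : D `&` E = set0 ->
  limit_content (D `|` E) = limit_content D + limit_content E.
Proof.
move=> DE.
suff c : gibbs_avg N \1_(D `|` E) @[N --> U] --> limit_content D + limit_content E.
  exact: cvg_lim c.
have -> : (fun N => gibbs_avg N \1_(D `|` E)) = fun N => gibbs_avg N \1_D + gibbs_avg N \1_E.
  apply/funext => N; symmetry.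
  rewrite -gibbs_avgD.
  congr gibbs_avg; apply/funext => x; rewrite !indicE in_setU.
  case: (boolP (x \in D)) => xD; case: (boolP (x \in E)) => xE; rewrite ?addr0 ?add0r//.
  have : (D `&` E) x by split; exact: set_mem.
  by rewrite DE.
by apply: cvgD; exact: cvg_limit_content.
Qed.

Lemma limit_content_shift (u : site d) D : limit_content (shift u @^-1` D) = limit_content D.
Proof.
apply/eqP; rewrite -subr_eq0 -normr_le0.
have h : `|gibbs_avg N \1_(shift u @^-1` D) - gibbs_avg N \1_D| @[N --> U] -->
    `|limit_content (shift u @^-1` D) - limit_content D|.
  by apply: cvg_norm; apply: cvgB; exact: cvg_limit_content.
have k : vol d R (N + norm_site u) / vol d R N - 1 @[N --> U] --> (0 : R).
  rewrite -(subrr 1); apply: cvgB; last exact: cvg_cst.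
  by apply: cvg_oo_ultra => //; exact: cvg_vol_ratio.
by apply: (cvg_le_ultra _ h k) => N; exact: gibbs_avg_shift.
Qed.

Definition limit_state : probability (X d a0) R :=
  extension_probability limit_content_ge0 limit_contentT limit_contentU.

Lemma limit_state_local D : local_set D -> limit_state D = (limit_content D)%:E.
Proof. exact: extension_local. Qed.

Lemma limit_state_invariant : shift_invariant limit_state.
Proof.
move=> u B mB.
pose su : {mfun X d a0 >-> X d a0} :=
  MeasurableFun.Pack (MeasurableFun.Class (isMeasurableFun.Build _ _ _ _ _ (@measurable_shift d A a0 u))).
apply: (@measure_eq_local d A a0 R (pushforward limit_state su) limit_state) => //.
  by change (limit_state setT < +oo)%E; exact: fin_num_fun_lty.
move=> D lD; change (limit_state (shift u @^-1` D) = limit_state D).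
by rewrite (limit_state_local (local_set_shift u lD)) (limit_state_local lD) limit_content_shift.
Qed.

Lemma limit_state_law n (t : pattern d A n) :
  gibbs_avg N \1_(cylinder t) @[N --> U] --> law limit_state t.
Proof.
rewrite /law limit_state_local; last exact: local_set_cylinder.
exact: cvg_limit_content.
Qed.

(** Convergence is known on cylinders, hence for local functions. Replacing phi by its value on
    patterns of radius k costs [v k] both before and after the limit. *)
Lemma limit_state_mean : gibbs_avg N phi @[N --> U] --> mean limit_state phi.
Proof.
have cv : gibbs_avg N phi @[N --> U] --> lim (gibbs_avg N phi @[N --> U]).
  apply: (@cvg_ultra_bounded _ _ _ _ M) => N.
  have -> : gibbs_avg N phi = gibbs_avg N phi - gibbs_avg N (fun=> 0) by rewrite gibbs_avg_cst subr0.
  by apply: gibbs_avg_near => x; rewrite subr0.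
set l := lim _ in cv.
suff -> : mean limit_state phi = l by [].
have near k : `|l - mean limit_state phi| <= v k + v k.
  pose phik x := phi (ext a0 (restr k x)).
  have pk x : `|phi x - phik x| <= v k by rewrite distrC; apply: v_var; exact: agree_ext_restr.
  have ck : gibbs_avg N phik @[N --> U] --> mean limit_state phik.
    rewrite (mean_local limit_state (fun w : pattern d A k => phi (ext a0 w))).
    have -> : (fun N => gibbs_avg N phik) =
        fun N => \sum_(t : pattern d A k) phi (ext a0 t) * gibbs_avg N \1_(cylinder t).
      apply/funext => N; rewrite -gibbs_avg_sum; congr gibbs_avg; apply/funext => x.
      rewrite (bigD1 (restr k x))//= big1 ?addr0.
        by rewrite indicE mem_set ?mulr1//; rewrite cylinderE.
      move=> t tx; rewrite indicE memNset ?mulr0// cylinderE/=.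
      by apply/eqP; rewrite eq_sym.
    apply: cvg_fin_sum => t; apply: cvgM; first exact: cvg_cst.
    exact: limit_state_law.
  have h1 : `|l - mean limit_state phik| <= v k.
    apply: (@cvg_le_ultra _ _ U _ _ _ _ _ (cvg_norm (cvgB cv ck)) (cvg_cst (v k))) => N.
    exact: gibbs_avg_near.
  have h2 : `|mean limit_state phik - mean limit_state phi| <= v k.
    apply: mean_near; [|exact: bounded_meas_phi|by move=> x; rewrite distrC].
    exact: (bounded_meas_local a0 (fun w : pattern d A k => phi (ext a0 w))).
  by apply: le_trans (ler_distD (mean limit_state phik) _ _) _; exact: lerD.
apply/esym/eqP; rewrite -subr_eq0 -normr_le0.
have v2 : (fun k => v k + v k) @ \oo --> (0 : R).
  by rewrite -(addr0 0); apply: cvgD; exact: cvg_v.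
exact: (@cvg_ge_ultra _ _ \oo _ _ _ _ v2).
Qed.

(** The case of equality in Gibbs' inequality: the logarithm of a Gibbs weight is the energy minus
    [ln Z]. *)
Lemma gibbs_entropy N :
  \sum_(w : pattern d A N) - (gibbs w * ln (gibbs w)) =
  ln (partition_function beta N) - beta * (gibbs_avg N phi * vol d R N).
Proof.
have Z0 := partition_function_gt0 beta N.
rewrite /gibbs_avg divfK ?gt_eqF ?vol_gt0// exchange_big/=.
under [in RHS]eq_bigr do rewrite -mulr_sumr -/(birkhoff phi N _).
rewrite -[in RHS](mul1r (ln _)) -(gibbs_sum N) mulr_suml mulr_sumr -sumrB.
apply: eq_bigr => w _; rewrite {2}/gibbs ln_div ?posrE ?expR_gt0// expRK; ring.
Qed.

(** Shearer passes from the Gibbs law on the large box to its windows of radius n, and concavity of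
    entropy from the windows to the averaged law. *)
Lemma gibbs_entropy_le n N :
  vol d R n * (\sum_(w : pattern d A N) - (gibbs w * ln (gibbs w))) <=
  vol d R N * (\sum_(t : pattern d A n)
     - (gibbs_avg N \1_(cylinder t) * ln (gibbs_avg N \1_(cylinder t)))) +
  (vol d R (N + n) - vol d R N) * #|{: pattern d A n}|%:R.
Proof.
have V0 := vol_gt0 d R N.
pose p (s : site d) (t : pattern d A n) : R :=
  \sum_(w : pattern d A N | restr n (shift s (ext a0 w)) == t) gibbs w.
have p0 s t : 0 <= p s t by apply: sumr_ge0 => w _; rewrite ltW// gibbs_gt0.
have p1 s : \sum_t p s t = 1.
  rewrite -(gibbs_sum N) [RHS](partition_big (fun w : pattern d A N => restr n (shift s (ext a0 w))) xpredT)//=.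
have ple1 s t : p s t <= 1.
  by rewrite -(p1 s) (bigD1 t)//= lerDl sumr_ge0.
have := @block_shearer d A a0 R (pattern d A N) (@gibbs N) (@ext d A a0 N) n N
  (fun w => ltW (gibbs_gt0 w)) (gibbs_sum N).
rewrite -/(vol d R n).
have -> : \sum_(t : pattern d A N) - ((\sum_(w : pattern d A N | restr N (ext a0 w) == t) gibbs w) *
    ln (\sum_(w : pattern d A N | restr N (ext a0 w) == t) gibbs w)) =
    \sum_(w : pattern d A N) - (gibbs w * ln (gibbs w)).
  apply: eq_bigr => t _.
  have -> : \sum_(w : pattern d A N | restr N (ext a0 w) == t) gibbs w = gibbs t.
    by rewrite (big_pred1 t)// => w; rewrite extK.
  by [].
move=> /le_trans; apply.
pose h s := \sum_t - (p s t * ln (p s t)).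
rewrite -[leLHS]/(\sum_(c : box d (N + n)) h (box_site c)).
(* Centres outside the box of radius N are few; each contributes at most 1 per pattern. *)
apply: le_trans (@box_sum_le d R N n h #|{: pattern d A n}|%:R _) _.
  move=> s; rewrite -[leRHS]mulr1 -sumr_constT; apply: ler_sum => t _.
  exact: xlogx_le1.
rewrite lerD2r.
have qE t : gibbs_avg N \1_(cylinder t) = (\sum_(c : box d N) p (box_site c) t) / vol d R N.
  rewrite /gibbs_avg; congr (_ / _); apply: eq_bigr => c _.
  rewrite /p [RHS]big_mkcond; apply: eq_bigr => w _; rewrite indicE cylinderE.
  case: eqP => h'; first by rewrite mem_set ?mulr1.
  by rewrite memNset ?mulr0.
(* Concavity: Gibbs' inequality for each window law against their average. *)
apply: (@le_trans _ _ (\sum_(c : box d N) - \sum_t p (box_site c) t * ln (gibbs_avg N \1_(cylinder t)))).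
  apply: ler_sum => c _; apply: gibbs_inequality => //.
  - by move=> t; have /andP[] := gibbs_avg_indic N (cylinder t).
  - move=> t pt; rewrite qE divr_gt0// (bigD1 c)//= ltr_pwDl// sumr_ge0//.
  - rewrite p1; under eq_bigr do rewrite qE.
    rewrite -mulr_suml exchange_big/=; under eq_bigr do rewrite p1.
    by rewrite sumr_constT mulr1 card_box_vol divff// gt_eqF.
rewrite sumrN exchange_big/= -sumrN mulr_sumr; apply: ler_sum => t _.
rewrite -mulr_suml mulrN mulrA {2}qE [vol d R N * _]mulrC divfK// gt_eqF//.
Qed.

(** The order of limits matters: N goes along U with the window radius n fixed, so only finitely
    many cylinders are involved; then n goes to infinity. *)
Lemma limit_state_ge : limit_pressure beta <= entropy limit_state + beta * mean limit_state phi.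
Proof.
have inv := limit_state_invariant.
rewrite -lerBlDr.
have [hcv _] := entropy_lim inv.
apply: (@cvg_ge_ultra _ _ \oo _ _ _ _ hcv) => n.
have Vn := vol_gt0 d R n.
rewrite ler_pdivlMr// mulrC.
have c1 : vol d R n * (pressure beta N - beta * gibbs_avg N phi) @[N --> U] -->
    vol d R n * (limit_pressure beta - beta * mean limit_state phi).
  apply: cvgM; first exact: cvg_cst.
  apply: cvgB; first exact: cvg_pressure.
  by apply: cvgM; [exact: cvg_cst|exact: limit_state_mean].
have c2 : (\sum_(t : pattern d A n)
     - (gibbs_avg N \1_(cylinder t) * ln (gibbs_avg N \1_(cylinder t)))) +
  (vol d R (N + n) / vol d R N - 1) * #|{: pattern d A n}|%:R @[N --> U] -->
   block_entropy limit_state n.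
  rewrite -[X in _ --> X]addr0; apply: cvgD.
    apply: cvg_fin_sum => t; apply: xlogx_cvg; last exact: limit_state_law.
    by move=> N; exact: gibbs_avg_indic.
  rewrite -[X in _ --> X](mul0r #|{: pattern d A n}|%:R); apply: cvgM; last exact: cvg_cst.
  rewrite -(subrr 1); apply: cvgB; last exact: cvg_cst.
  by apply: cvg_oo_ultra => //; exact: cvg_vol_ratio.
apply: (@cvg_le_ultra _ _ U _ _ _ _ _ c1 c2) => N.
have VN := vol_gt0 d R N.
have := gibbs_entropy_le n N; rewrite gibbs_entropy => h.
rewrite -(ler_pM2r VN) mulrDl -!mulrA.
have -> : vol d R n * ((pressure beta N - beta * gibbs_avg N phi) * vol d R N) =
   vol d R n * (ln (partition_function beta N) - beta * (gibbs_avg N phi * vol d R N)).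
  by rewrite mulrBl /pressure divfK ?gt_eqF// mulrA.
apply: le_trans h _.
rewrite le_eqVlt; apply/orP; left; apply/eqP.
by field; rewrite gt_eqF.
Qed.

Lemma variational_max : exists2 nu : probability (X d a0) R, shift_invariant nu &
  limit_pressure beta <= entropy nu + beta * mean nu phi.
Proof. by exists limit_state; [exact: limit_state_invariant|exact: limit_state_ge]. Qed.

End Ultrafilter.
End LimitState.

(** * Strict convexity of the pressure *)

Section WindowReplacement.
Variables (d : nat) (A : finType) (a0 : A) (m : nat).
Implicit Types (u : site d) (r : pattern d A m) (x : X d a0).

Definition replace u r x : X d a0 :=
  fun w => if (norm_site (sub_site w u) <= m)%N then r (unbox m (sub_site w u)) else x w.

Lemma replace_out u r x w : (m < norm_site (sub_site w u))%N -> replace u r x w = x w.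
Proof. by rewrite /replace ltnNge; case: ifP. Qed.

Lemma shift_replace u r x : agree m (shift u (replace u r x)) (ext a0 r).
Proof.
by move=> w wm; rewrite /shift /replace /ext -/(add_site w u) add_siteK wm.
Qed.

Lemma replaceC u u' r r' x :
  (forall w, ~~ ((norm_site (sub_site w u) <= m) && (norm_site (sub_site w u') <= m))%N) ->
  replace u r (replace u' r' x) = replace u' r' (replace u r x).
Proof.
move=> disj; apply/funext => w; rewrite /replace; have := disj w.
by case: (norm_site (sub_site w u) <= m)%N; case: (norm_site (sub_site w u') <= m)%N.
Qed.

Lemma replaceK u r x : replace u (restr m (shift u x)) (replace u r x) = x.
Proof.
apply/funext => w; rewrite /replace; case: ifP => wu; last by rewrite wu.
by rewrite ffunE unboxK// /shift -/(add_site (sub_site w u) u) sub_siteK.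
Qed.

Lemma ext_restr_replace N u r (w : pattern d A N) : (norm_site u + m <= N)%N ->
  ext a0 (restr N (replace u r (ext a0 w))) = replace u r (ext a0 w).
Proof.
move=> uN; apply/funext => t; have [tN|tN] := leqP (norm_site t) N.
  exact: agree_ext_restr.
have tu : (m < norm_site (sub_site t u))%N.
  by have := norm_add_site (sub_site t u) u; rewrite sub_siteK; lia.
by rewrite replace_out// /ext leqNgt tN.
Qed.

(** A lattice of spacing 2m + 1, so that windows of radius m do not overlap. A list numbers the
    windows, as [hoelder_gain_windows] requires. *)
Definition centers (k : nat) : seq (site d) :=
  [seq (fun i => (box_site c i) * (m.*2.+1)%:Z) | c <- enum {: box d k}].

Definition center (k j : nat) : site d := nth (fun=> 0) (centers k) j.

Lemma center_box k j : (j < #|{: box d k}|)%N ->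
  exists2 c : box d k, c = nth [ffun=> ord0] (enum {: box d k}) j &
    center k j = fun i => (box_site c i) * (m.*2.+1)%:Z.
Proof.
move=> jk; exists (nth [ffun=> ord0] (enum {: box d k}) j) => //.
by rewrite /center /centers (nth_map [ffun=> ord0])// -cardE.
Qed.

Lemma norm_center k j : (j < #|{: box d k}|)%N -> (norm_site (center k j) <= m.*2.+1 * k)%N.
Proof.
move=> jk; have [c _ ->] := center_box jk; apply/bigmax_leqP => i _.
have := coord_le_norm (box_site c) i; have := norm_box_site c.
move: (box_site c i) (norm_site (box_site c)) => z n nk zn.
have zk : (absz z <= k)%N by lia.
by rewrite abszM absz_nat mulnC leq_mul2l zk orbT.
Qed.

Lemma center_disjoint k i j w : (i < #|{: box d k}|)%N -> (j < #|{: box d k}|)%N -> i != j ->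
  ~~ ((norm_site (sub_site w (center k i)) <= m) && (norm_site (sub_site w (center k j)) <= m))%N.
Proof.
move=> ik jk ij; have [c cE ->] := center_box ik; have [c' cE' ->] := center_box jk.
have cc' : c != c' by rewrite cE cE' nth_uniq ?enum_uniq -?cardE.
apply/negP => /andP[h h']; case/negP: cc'; apply/eqP/ffunP => l; apply/val_inj.
have := coord_le_norm (sub_site w (fun i => box_site c i * (m.*2.+1)%:Z)) l.
have := coord_le_norm (sub_site w (fun i => box_site c' i * (m.*2.+1)%:Z)) l.
rewrite /sub_site.
have e : box_site c l * (m.*2.+1)%:Z - box_site c' l * (m.*2.+1)%:Z =
    ((c l)%:Z - (c' l)%:Z) * (m.*2.+1)%:Z by rewrite /box_site; ring.
move: (norm_site _) (norm_site _) h h' => n n' h h'.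
move: (box_site c l * _) (box_site c' l * _) e => y y' e h1 h2.
have : (absz (y - y') <= m.*2)%N by lia.
rewrite e abszM absz_nat; case: (eqVneq (c l : nat) (c' l)) => // cl h3.
have h4 : (1 <= absz ((c l)%:Z - (c' l)%:Z))%N by lia.
have : (m.*2.+1 <= absz ((c l)%:Z - (c' l)%:Z) * m.*2.+1)%N by rewrite leq_pmull.
lia.
Qed.

End WindowReplacement.

Section StrictConvexity.
Variables (d : nat) (A : finType) (a0 : A) (R : realType) (phi : X d a0 -> R).
Variables (v : nat -> R) (C M : R).
Hypothesis d_gt0 : (0 < d)%N.
Hypothesis v_ge0 : forall k, 0 <= v k.
Hypothesis v_sum : forall n, \sum_(k < n) (k.+1 ^ d.-1)%:R * v k <= C.
Hypothesis v_var : forall k (x y : X d a0), agree k x y -> `|phi x - phi y| <= v k.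
Hypothesis phi_bound : forall x, `|phi x| <= M.
Local Notation S := (birkhoff phi).
Local Notation E := (shell_bound d C).

(** One error accounts for terms based outside the window, and one for each of r and s when its
    surroundings are replaced by [a0]. *)
Lemma birkhoff_replace N m (u : site d) (r s : pattern d A m) x : (norm_site u + m <= N)%N ->
  `|(S N (replace u r x) - S N (replace u s x)) - (S m (ext a0 r) - S m (ext a0 s))| <= E m *+ 3.
Proof.
move=> uN.
have h1 := birkhoff_local_change d_gt0 v_ge0 v_sum v_var (x := replace u r x) (y := replace u s x) uN
  (fun w wu => etrans (replace_out r x wu) (esym (replace_out s x wu))).
have h2 := birkhoff_agree d_gt0 v_ge0 v_sum v_var (@shift_replace d A a0 m u r x).
have h3 := birkhoff_agree d_gt0 v_ge0 v_sum v_var (@shift_replace d A a0 m u s x).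
move: h1 h2 h3; rewrite !ler_norml => /andP[a1 b1] /andP[a2 b2] /andP[a3 b3].
by apply/andP; split; lra.
Qed.

Lemma C_ge0 : 0 <= C.
Proof. by have := v_sum 0; rewrite big_ord0. Qed.

Lemma shell_bound_ge0 m : 0 <= E m.
Proof. by rewrite mulr_ge0// C_ge0. Qed.

Section Gain.
Variables (m : nat) (p q : pattern d A m).
(** [D0] and [D1] bound from below and above, for all surroundings, the energy change when a window
    shows p instead of q. *)
Let D0 := S m (ext a0 p) - S m (ext a0 q) - E m *+ 3.
Let D1 := S m (ext a0 p) - S m (ext a0 q) + E m *+ 3.
Hypothesis D0_gt0 : 0 < D0.
Variables b1 b2 : R.
Hypothesis b1_gt0 : 0 < b1.
Hypothesis b12 : b1 * D1 < b2 * D0.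
Let T := vol d R m * M *+ 2 + E m *+ 3.

Let D01 : D0 <= D1.
Proof. by have := shell_bound_ge0 m; rewrite /D0 /D1; lra. Qed.

Let b12' : b1 <= b2.
Proof.
rewrite leNgt; apply/negP => h; move: b12.
have := ler_wpM2r (ltW D0_gt0) (ltW h); have := ler_wpM2l (ltW b1_gt0) D01; lra.
Qed.

Let b2_gt0 : 0 < b2. Proof. exact: lt_le_trans b12'. Qed.

Let diff_le_T (r s : pattern d A m) : S m (ext a0 r) - S m (ext a0 s) + E m *+ 3 <= T.
Proof.
have := birkhoff_bound phi_bound m (ext a0 r); have := birkhoff_bound phi_bound m (ext a0 s).
rewrite !ler_norml => /andP[x1 y1] /andP[x2 y2]; rewrite /T; lra.
Qed.

Let T_ge0 : 0 <= T.
Proof. by have := diff_le_T p p; have := shell_bound_ge0 m; lra. Qed.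

Let a := expR (b1 * D1).
Let b := expR (b2 * D0).
Let c := expR (b2 * T).
(** The defect of [hoelder_gain] for Boltzmann weights: writing p for q multiplies the weight by at
    most a at [b1] and at least b at [b2], and any replacement of q multiplies it by at most c,
    since T bounds all energy changes. *)
Definition gain : R := (Num.sqrt b - Num.sqrt a) ^+ 2 / (c * #|{: pattern d A m}|%:R) ^+ 2.

Let P_ge1 : 1 <= #|{: pattern d A m}|%:R :> R.
Proof. by rewrite ler1n; apply/card_gt0P; exists p. Qed.

Lemma gain_gt0 : 0 < gain.
Proof.
apply: divr_gt0; last by rewrite exprn_gt0// mulr_gt0 ?expR_gt0// (lt_le_trans ltr01).
by rewrite exprn_gt0// subr_gt0 ltr_sqrt ?expR_gt0// ltr_expR.
Qed.

(** Keeps [1 - gain] nonnegative, so that its powers can be compared with those of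
    [expR (- gain)]. *)
Lemma gain_le1 : gain <= 1.
Proof.
have c1 : 1 <= c by rewrite -expR0 ler_expR mulr_ge0// ltW.
have cP : 1 <= c * #|{: pattern d A m}|%:R.
  by rewrite -[leLHS]mulr1 ler_pM.
rewrite ler_pdivrMr ?mul1r ?exprn_gt0 ?(lt_le_trans ltr01 cP)//.
apply: (@le_trans _ _ b).
  rewrite -[leRHS]sqr_sqrtr ?expR_ge0// ler_sqr ?nnegrE ?sqrtr_ge0//.
    by rewrite gerBl sqrtr_ge0.
  by rewrite subr_ge0 ler_sqrt ?expR_ge0// ler_expR ltW.
apply: (@le_trans _ _ c).
  rewrite ler_expR ler_wpM2l// ?(ltW b2_gt0)//.
  by apply: le_trans (diff_le_T p q); exact: D01.
have h : c <= c * #|{: pattern d A m}|%:R by rewrite ler_peMr// expR_ge0.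
apply: (le_trans h); rewrite expr2 ler_peMr//; exact: le_trans ler01 cP.
Qed.

Lemma partition_function_gain N k : (m.*2.+1 * k + m <= N)%N ->
  partition_function phi ((b1 + b2) / 2) N ^+ 2 <=
  (1 - gain) ^+ #|{: box d k}| * (partition_function phi b1 N * partition_function phi b2 N).
Proof.
move=> kN; set K := #|_|.
pose repl (j : nat) (r : pattern d A m) (w : pattern d A N) := restr N (replace (@center d m k j) r (ext a0 w)).
pose read (j : nat) (w : pattern d A N) := restr m (shift (@center d m k j) (ext a0 w)).
have cN j : (j < K)%N -> (norm_site (@center d m k j) + m <= N)%N.
  by move=> jK; apply: leq_trans kN; rewrite leq_add2r; exact: norm_center.
have ext_repl j r w : (j < K)%N -> ext a0 (repl j r w) = replace (@center d m k j) r (ext a0 w).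
  by move=> jK; apply: ext_restr_replace; exact: cN.
have SP j r s w : (j < K)%N ->
    S m (ext a0 r) - S m (ext a0 s) - E m *+ 3 <= S N (ext a0 (repl j r w)) - S N (ext a0 (repl j s w))
    <= S m (ext a0 r) - S m (ext a0 s) + E m *+ 3.
  move=> jK; rewrite !ext_repl//.
  by have := birkhoff_replace r s (ext a0 w) (cN j jK); rewrite ler_distl.
have expP (beta y z D : R) : 0 < beta -> y - z <= D -> expR (beta * y) <= expR (beta * D) * expR (beta * z).
  move=> b0 h; rewrite -expRD ler_expR -mulrDr ler_wpM2l ?(ltW b0)//; lra.
have := @hoelder_gain_windows R (pattern d A N) (pattern d A m) K repl read _ _ _
  (fun w => expR (b1 * S N (ext a0 w))) (fun w => expR (b2 * S N (ext a0 w))) p q a b c.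
rewrite -/gain.
(* The geometric mean of the weights at b1 and b2 is the weight at the midpoint. *)
have -> : \sum_(w : pattern d A N) Num.sqrt (expR (b1 * S N (ext a0 w)) * expR (b2 * S N (ext a0 w))) =
   partition_function phi ((b1 + b2) / 2) N.
  apply: eq_bigr => w _; rewrite -expRD.
  have -> : b1 * S N (ext a0 w) + b2 * S N (ext a0 w) = ((b1 + b2) / 2 * S N (ext a0 w)) *+ 2 by field.
  by rewrite -mulr_natl expRM_natl sqrtr_sqr ger0_norm// expR_ge0.
apply => //.
- by move=> j r w jK; rewrite /repl ext_repl// /read replaceK extK.
- move=> j r w jK; rewrite /read ext_repl// -[RHS](@extK d A a0 m); apply/restr_eqP.
  exact: shift_replace.
- move=> i j r s w iK jK ij; rewrite /repl; congr restr.
  by rewrite -!/(repl _ _ _) !ext_repl//; apply: replaceC => t; exact: center_disjoint.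
- by move=> w; exact: expR_gt0.
- by move=> w; exact: expR_gt0.
- exact: expR_gt0.
- by rewrite ltr_expR.
- exact: expR_gt0.
- by move=> j w jK; apply: expP => //; have /andP[] := SP j p q w jK.
- move=> j w jK; rewrite /b -expRD ler_expR -mulrDr ler_wpM2l ?(ltW b2_gt0)//.
  by have /andP[] := SP j p q w jK; rewrite /D0; lra.
- move=> j w r jK.
  apply: (@le_trans _ _ (expR (b1 * T) * expR (b1 * S N (ext a0 (repl j q w))))).
    apply: expP => //; have /andP[_ h] := SP j r q w jK; exact: le_trans h (diff_le_T r q).
  by rewrite ler_wpM2r ?expR_ge0// ler_expR ler_wpM2r.
- move=> j w r jK; apply: expP => //; have /andP[_ h] := SP j r q w jK.
  exact: le_trans h (diff_le_T r q).
Qed.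

Lemma pressure_gain N : (m <= N)%N ->
  2 * pressure phi ((b1 + b2) / 2) N + gain / (3 * m.*2.+1)%:R ^+ d <=
  pressure phi b1 N + pressure phi b2 N.
Proof.
move=> mN.
pose k := ((N - m) %/ m.*2.+1)%N.
have kN : (m.*2.+1 * k + m <= N)%N by have := leq_divM (N - m) m.*2.+1; rewrite /k mulnC; lia.
have V0 := vol_gt0 d R N.
have Z0 beta := partition_function_gt0 phi beta N.
(* Maximality of k gives [2N + 1 < (2m + 1) (2k + 3)], and [2k + 3 <= 3 (2k + 1)]: the number of
   windows is proportional to the volume. *)
have volK : vol d R N <= (3 * m.*2.+1)%:R ^+ d * #|{: box d k}|%:R.
  rewrite card_box_vol /vol -exprMn lerXn2r ?nnegrE// -natrM ler_nat.
  have := ltn_ceil (N - m) (isT : (0 < m.*2.+1)%N); rewrite -/k; nia.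
have := partition_function_gain kN; move: (#|{: box d k}|) volK => K volK h.
have g1 : 1 - gain <= expR (- gain) by exact: expR_ge1Dx.
have h2 : partition_function phi ((b1 + b2) / 2) N ^+ 2 <=
   expR (- gain) ^+ K * (partition_function phi b1 N * partition_function phi b2 N).
  apply: le_trans h _; rewrite ler_wpM2r ?mulr_ge0 ?(ltW (Z0 _))//.
  by rewrite lerXn2r ?nnegrE ?expR_ge0// subr_ge0 gain_le1.
move: h2; rewrite -ler_ln ?posrE ?mulr_gt0 ?exprn_gt0 ?expR_gt0//.
rewrite lnM ?posrE ?mulr_gt0 ?exprn_gt0 ?expR_gt0// lnM ?posrE// !lnXn ?expR_gt0// expRK => h3.
rewrite /pressure mulrA -mulrDl ler_pdivlMr// mulrDl divfK ?gt_eqF//.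
have L0 : 0 < (3 * m.*2.+1)%:R ^+ d :> R by rewrite exprn_gt0// ltr0n.
have h4 : gain / (3 * m.*2.+1)%:R ^+ d * vol d R N <= gain *+ K.
  rewrite -mulrA -[leRHS]mulr_natr ler_wpM2l ?(ltW gain_gt0)//.
  by rewrite mulrC ler_pdivrMr// mulrC.
move: h3; rewrite mulNrn mulr2n; lra.
Qed.

Lemma limit_pressure_gain (U : set_system nat) : UltraFilter U -> \oo `<=` U ->
  2 * limit_pressure phi U ((b1 + b2) / 2) + gain / (3 * m.*2.+1)%:R ^+ d <=
  limit_pressure phi U b1 + limit_pressure phi U b2.
Proof.
move=> UU ooU.
have cp beta := cvg_pressure phi_bound UU beta.
rewrite -subr_ge0.
have cv : pressure phi b1 N + pressure phi b2 N - (2 * pressure phi ((b1 + b2) / 2) N + gain / (3 * m.*2.+1)%:R ^+ d)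
   @[N --> U] --> limit_pressure phi U b1 + limit_pressure phi U b2 -
   (2 * limit_pressure phi U ((b1 + b2) / 2) + gain / (3 * m.*2.+1)%:R ^+ d).
  apply: cvgB; first by apply: cvgD; exact: cp.
  apply: cvgD; last exact: cvg_cst.
  by apply: cvgM; [exact: cvg_cst|exact: cp].
rewrite -(cvg_lim _ cv)//; apply: limr_ge; first exact: cvgP cv.
have : U [set N | (m <= N)%N] by apply: ooU; exact: nbhs_infty_ge.
by apply: filterS => N mN; rewrite subr_ge0; exact: pressure_gain.
Qed.

End Gain.

(** Under the product of the two laws, the Birkhoff sums of a pair of patterns differ by at most a
    surface term, negligible against the volume. *)
Lemma mean_constant :
  (forall m (p q : pattern d A m), S m (ext a0 p) - S m (ext a0 q) <= E m *+ 3) ->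
  forall nu nu' : probability (X d a0) R, shift_invariant nu -> shift_invariant nu' ->
  mean nu phi <= mean nu' phi.
Proof.
move=> h nu nu' inv inv'.
(* Five errors: three from the comparison of patterns and one from [mean_birkhoff] for each
   measure. *)
have main N : mean nu phi - mean nu' phi <= 5 * (E N / vol d R N).
  have V0 := vol_gt0 d R N.
  rewrite mulrA ler_pdivlMr//.
  have := mean_birkhoff d_gt0 v_ge0 v_sum v_var phi_bound N inv.
  have := mean_birkhoff d_gt0 v_ge0 v_sum v_var phi_bound N inv'.
  set s := \sum_w _; set s' := \sum_w _.
  have : s' - s <= E N *+ 3.
    have -> : s' = \sum_(w : pattern d A N) \sum_(w' : pattern d A N) law nu w * law nu' w' * S N (ext a0 w).
      apply: eq_bigr => w _; rewrite -mulr_suml -mulr_sumr law_sum1 mulr1//.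
    have -> : s = \sum_(w : pattern d A N) \sum_(w' : pattern d A N) law nu w * law nu' w' * S N (ext a0 w').
      rewrite exchange_big/=; apply: eq_bigr => w _.
      by rewrite -mulr_suml -mulr_suml law_sum1 mul1r.
    have -> : E N *+ 3 = \sum_(w : pattern d A N) \sum_(w' : pattern d A N) law nu w * law nu' w' * (E N *+ 3).
      under eq_bigr do rewrite -mulr_suml -mulr_sumr law_sum1 mulr1.
      by rewrite -mulr_suml law_sum1 mul1r.
    rewrite -sumrB; apply: ler_sum => w _; rewrite -sumrB; apply: ler_sum => w' _.
    by rewrite -mulrBr ler_wpM2l// mulr_ge0 ?law_ge0.
  rewrite !ler_norml => h1 /andP[h2 h3] /andP[h4 h5]; lra.
have cv : 5 * (E N / vol d R N) @[N --> \oo] --> (0 : R).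
  rewrite -[X in _ --> X](mulr0 5); apply: cvgM; first exact: cvg_cst.
  exact: cvg_shell_bound.
rewrite -subr_le0.
by apply: (@cvg_le_ultra _ _ \oo (fun=> mean nu phi - mean nu' phi) _ _ _ _ _ cv main); exact: cvg_cst.
Qed.

End StrictConvexity.

(** * Freezing transitions *)

Lemma succ_expn_le (e k : nat) : (0 < k)%N -> (k.+1 ^ e <= 2 ^ e * k ^ e)%N.
Proof. by move=> k0; rewrite -expnMn; case: e => // e; rewrite leq_exp2r//; lia. Qed.

Section Variations.
Variables (R : realType) (d : nat) (A : finType) (a0 : A) (phi : X d a0 -> R).
Implicit Types x y : X d a0.

Lemma var_ge0 n : (0 <= var phi n)%E.
Proof.
apply: ereal_sup_ubound; exists (fun=> a0), (fun=> a0).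
by split => //; rewrite subrr normr0.
Qed.

Lemma var_ub n x y : agree n x y -> (`|phi x - phi y|%:E <= var phi n)%E.
Proof.
move=> h; apply: ereal_sup_ubound; exists x, y; split => // w /in_boxP; exact: h.
Qed.

Lemma variation_modulus : (\sum_(1 <= n <oo) ((n ^ (d - 1))%:R%:E * var phi n) < +oo)%E ->
  exists (v : nat -> R) (C M : R),
  [/\ forall k, 0 <= v k,
      forall n, \sum_(k < n) (k.+1 ^ d.-1)%:R * v k <= C,
      forall k x y, agree k x y -> `|phi x - phi y| <= v k &
      forall x, `|phi x| <= M].
Proof.
move=> var_summable.
have term_ge0 n : (0 <= (n ^ (d - 1))%:R%:E * var phi n)%E.
  by rewrite mule_ge0 ?var_ge0// lee_fin.
set total := (X in (X < _)%E) in var_summable.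
have partial n : (\sum_(1 <= k < n) (k ^ (d - 1))%:R%:E * var phi k <= total)%E.
  by apply: nneseries_lim_ge => k _ _; exact: term_ge0.
have varE n : (0 < n)%N -> var phi n = (fine (var phi n))%:E.
  move=> n0; rewrite fineK// ge0_fin_numE ?var_ge0//.
  apply: le_lt_trans var_summable; apply: le_trans (partial n.+1).
  rewrite big_nat_recr//=; apply: (@le_trans _ _ ((n ^ (d - 1))%:R%:E * var phi n)%E).
    by rewrite -[leLHS]mul1e lee_wpmul2r ?var_ge0// lee_fin ler1n expn_gt0 n0.
  by rewrite leeDr// sume_ge0.
have totalE : total = (fine total)%:E.
  by rewrite fineK// ge0_fin_numE//; apply: nneseries_ge0 => n _ _; exact: term_ge0.
(* A finite [var phi 1] bounds phi, because there are finitely many patterns of radius 1. *)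
pose M := fine (var phi 1) + \sum_(w : pattern d A 1) `|phi (ext a0 w)|.
have phiM x : `|phi x| <= M.
  have h : `|phi (ext a0 (restr 1 x))| <= \sum_(w : pattern d A 1) `|phi (ext a0 w)|.
    by rewrite (bigD1 (restr 1 x))//= lerDl sumr_ge0.
  have := var_ub (@agree_ext_restr d A a0 1 x); rewrite varE// lee_fin distrC => h'.
  rewrite -(subrK (phi (ext a0 (restr 1 x))) (phi x)).
  by apply: le_trans (ler_normD _ _) _; exact: lerD.
(* The series starts at n = 1 and says nothing about [var phi 0]. *)
pose v k := if k is k'.+1 then fine (var phi k) else M *+ 2.
have M0 : 0 <= M by exact: le_trans (phiM (fun=> a0)).
have v0 k : 0 <= v k.
  by case: k => [|k] /=; [rewrite mulrn_wge0|rewrite fine_ge0 ?var_ge0].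
(* The first summand pays for [v 0]. The weights are one index ahead of those of the series, which
   costs at most a factor 2^(d-1). *)
exists v, (M *+ 2 + (2 ^ d.-1)%:R * fine total), M; split=> //.
- move=> n; apply: (@le_trans _ _ (\sum_(k < n.+1) (k.+1 ^ d.-1)%:R * v k)).
    by rewrite big_ord_recr/= lerDl mulr_ge0.
  rewrite big_ord_recl/= exp1n mul1r lerD2l.
  have := partial n.+1; rewrite totalE big_add1/= big_mkord.
  rewrite (eq_bigr (fun k : 'I_n => ((k.+1 ^ d.-1)%:R * v k.+1)%:E)); last first.
    by move=> k _; rewrite /= subn1 [in LHS]varE// EFinM.
  rewrite sumEFin lee_fin => h.
  apply: (@le_trans _ _ ((2 ^ d.-1)%:R * \sum_(k < n) (k.+1 ^ d.-1)%:R * v k.+1)); last first.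
    by rewrite ler_wpM2l.
  rewrite mulr_sumr; apply: ler_sum => k _.
  rewrite mulrA ler_wpM2r ?fine_ge0 ?var_ge0// -natrM ler_nat.
  exact: succ_expn_le.
- move=> [|k] x y xy /=.
    by rewrite mulr2n; apply: le_trans (ler_normB _ _) _; exact: lerD.
  by have := var_ub xy; rewrite varE// lee_fin.
Qed.

End Variations.

(** The energy term is then a constant, and every [ES beta phi] is the set of invariant measures of
    maximal entropy. *)
Lemma ES_eq_of_mean_constant (R : realType) (d : nat) (A : finType) (a0 : A)
    (phi : X d a0 -> R) : bounded_meas phi ->
  (forall nu nu' : probability (X d a0) R, shift_invariant nu -> shift_invariant nu' ->
    mean nu phi <= mean nu' phi) ->
  forall beta beta', ES beta phi = ES beta' phi.
Proof.
move=> bphi h beta beta'.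
have E (b : R) (mu nu : probability (X d a0) R) : shift_invariant mu -> shift_invariant nu ->
    (free_energy b phi nu <= free_energy b phi mu)%E = (entropy nu <= entropy mu).
  move=> imu inu; rewrite /free_energy !meanE// -!EFinM -!EFinD lee_fin.
  have -> : mean nu phi = mean mu phi by apply/le_anti; rewrite !h.
  by rewrite lerD2r.
by apply/seteqP; split=> mu [imu hmu]; split=> // nu inu; have := hmu _ inu; rewrite !E.
Qed.

Theorem theoremB (R : realType) (d : nat) (A : finType) (a0 : A)
    (phi : X d a0 -> R) :
  (0 < d)%N ->
  cont_potential phi ->
  (\sum_(1 <= n <oo) ((n ^ (d - 1))%:R%:E * var phi n) < +oo)%E ->
  ~ (exists beta_c : R, freezing_transition phi beta_c).
Proof.
move=> d0 _ sv [bc [frozen distinct]].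
have [v [C [M [v0 vC vphi phiM]]]] := variation_modulus sv.
have bphi := bounded_meas_phi v0 vC vphi phiM.
have [h|/existsNP[m /existsNP[p /existsNP[q /negP]]]] :=
  pselect (forall m (p q : pattern d A m),
    birkhoff phi m (ext a0 p) - birkhoff phi m (ext a0 q) <= shell_bound d C m *+ 3).
  apply: (distinct (bc - 1) (bc + 1)); [lra|lra|].
  apply: ES_eq_of_mean_constant => //.
  exact: (mean_constant d0 v0 vC vphi phiM h).
rewrite -ltNge -subr_gt0 => D0.
have E0 := shell_bound_ge0 vC m.
set D := _ - _ in D0.
have [U [UU ooU]] := @ultraFilterLemma nat \oo _.
pose D1 := birkhoff phi m (ext a0 p) - birkhoff phi m (ext a0 q) + shell_bound d C m *+ 3.
have DD1 : D <= D1 by rewrite /D /D1; lra.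
have D1_gt0 : 0 < D1 by exact: lt_le_trans DD1.
(* The absolute value makes b1 positive even for negative bc; b2 is chosen so that
   [b2 * D = b1 * D1 + b1 * D]. *)
pose b1 := `|bc| + 1.
pose b2 := b1 * (D1 / D + 1).
have b1_gt0 : 0 < b1 by rewrite ltr_wpDl.
have bc1 : bc < b1 by rewrite /b1; have := ler_norm bc; lra.
have b12 : b1 * D1 < b2 * D.
  have -> : b2 * D = b1 * D1 + b1 * D by rewrite /b2 -mulrA [(_ + 1) * D]mulrDl divfK ?gt_eqF// mul1r mulrDr.
  by rewrite ltrDl mulr_gt0.
have bc2 : bc < b2.
  by apply: (lt_trans bc1); rewrite ltr_pMr// ltrDr divr_gt0.
have le_P b nu : shift_invariant nu -> entropy nu + b * mean nu phi <= limit_pressure phi U b.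
  by move=> inv; eapply variational_le; eassumption.
have freeE b (nu : probability (X d a0) R) :
    free_energy b phi nu = (entropy nu + b * mean nu phi)%:E.
  by rewrite /free_energy meanE.
(* Comparison with the maximizer of [variational_max] turns optimality among invariant measures into
   attaining the limit pressure. *)
have ESP b (nu : probability (X d a0) R) : ES b phi nu <->
    shift_invariant nu /\ limit_pressure phi U b <= entropy nu + b * mean nu phi.
  split=> -[inv hnu]; split=> //.
    have [nu' inv' le'] : exists2 nu' : probability (X d a0) R, shift_invariant nu' &
      limit_pressure phi U b <= entropy nu' + b * mean nu' phi by eapply variational_max; eassumption.
    by have := hnu _ inv'; rewrite !freeE lee_fin; exact: le_trans.
  by move=> nu' inv'; rewrite !freeE lee_fin; apply: le_trans hnu; exact: le_P.
have [nu inv le1] : exists2 nu : probability (X d a0) R, shift_invariant nu &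
  limit_pressure phi U b1 <= entropy nu + b1 * mean nu phi by eapply variational_max; eassumption.
have /ESP[_ le2] : ES b2 phi nu by rewrite -(frozen b1 b2)//; exact/ESP.
have lem := le_P ((b1 + b2) / 2) nu inv.
have := limit_pressure_gain d0 v0 vC vphi phiM D0 b1_gt0 b12 UU ooU.
have := gain_gt0 M b12.
set g := gain _ _ _ _ _ _ _ => g0.
have : 0 < g / (3 * m.*2.+1)%:R ^+ d by rewrite divr_gt0// exprn_gt0// ltr0n.
move: (g / _) => k k0.
move: (limit_pressure phi U b1) (limit_pressure phi U b2) (limit_pressure phi U _) le1 le2 lem => P1 P2 P3.
have -> : (b1 + b2) / 2 * mean nu phi = (b1 * mean nu phi + b2 * mean nu phi) / 2 by field.
move: (b1 * _) (b2 * _) => x1 x2; lra.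
Qed.
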